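(* Let $k$ be a commutative ring and let $\mathsf C$ be a $k$-linear Hom-finite abelian length category. Suppose that each indecomposable object in $\mathsf C$ is the source of a left almost split morphism. Let $\mathsf U\subseteq\mathsf{Sp}\,\mathsf C$ be an infinite subobject-closed subset which is minimal with respect to this property (that is, minimal among all infinite subobject-closed subsets of $\mathsf{Sp}\,\mathsf C$). Then the following conditions are equivalent. (1) $\mathsf U$ is compact. (2) $\mathsf U$ contains an infinite character. (3) $\mathsf U$ is of the form $\mathsf{sub}\,\chi$ for some irreducible character $\chi$ for $\mathsf C$.
   Context: An abelian length category is an abelian category in which every object has finite length. Hom-finite means that each morphism set in $\mathsf C$ has finite length as a $k$-module. $\mathbb N$ contains $0$. A morphism $\phi\colon M\to N$ in $\mathsf C$ is left almost split if $\phi$ is not a split monomorphism and every morphism $M\to N'$ in $\mathsf C$ which is not a split monomorphism factors through $\phi$. For an additive category $\mathsf D$ with cokernels, a character for $\mathsf D$ is a function $\chi\colon \mathrm{Ob}\,\mathsf D\to\mathbb N$ such that (i) $\chi(X\oplus Y)=\chi(X)+\chi(Y)$ for all objects $X,Y$, and (ii) $\chi(X)+\chi(Z)\ge\chi(Y)$ for each exact sequence $X\to Y\to Z\to 0$ in $\mathsf D$ (i.e. $Y\to Z$ is a cokernel of $X\to Y$). A character $\chi\neq 0$ is irreducible if it cannot be written as a sum of two non-zero characters. $\mathsf{Sp}\,\mathsf D$ denotes the set of irreducible characters for $\mathsf D$. For an object $M$ of $\mathsf C$ let $\chi_M(X)=\mathrm{length}_{\mathrm{End}(M)}\mathrm{Hom}(X,M)$.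 A character of the form $\chi_M$ with $M$ in $\mathsf C$ is called finite; otherwise it is called infinite. Topology on $\mathsf{Sp}\,\mathsf C$: for a morphism $\alpha\colon X\to Y$ in $\mathsf C$ set $\chi(\alpha)=\chi(X)-\chi(Y)+\chi(\mathrm{Coker}\,\alpha)$; the sets $\mathsf U_\alpha=\{\chi\in\mathsf{Sp}\,\mathsf C\mid\chi(\alpha)\ne 0\}$ form a basis of open sets. Compactness of $\mathsf U$ is with respect to the subspace topology (every open cover has a finite subcover). A full additive subcategory $\mathsf D\subseteq\mathsf C$ is subobject-closed if each subobject of an object in $\mathsf D$ belongs to $\mathsf D$. Then the inclusion $\mathsf D\to\mathsf C$ has a left adjoint $p$ (taking $X$ to $X/U$, where $U\subseteq X$ is the minimal subobject with $X/U\in\mathsf D$), so $\mathsf D$ has cokernels. The map $\mathsf{Sp}\,\mathsf D\to\mathsf{Sp}\,\mathsf C$, $\chi\mapsto\chi\circ p$, identifies $\mathsf{Sp}\,\mathsf D$ with a subset of $\mathsf{Sp}\,\mathsf C$, namely the closure of $\{\chi_M\in\mathsf{Sp}\,\mathsf C\mid M\in\mathsf D\}$. A subset $\mathsf U\subseteq\mathsf{Sp}\,\mathsf C$ is subobject-closed if $\mathsf U=\mathsf{Sp}\,\mathsf D$ for some subobject-closed full additive subcategory $\mathsf D\subseteq\mathsf C$. Intersections of subobject-closed subsets are again subobject-closed. For $\chi\in\mathsf{Sp}\,\mathsf C$, $\mathsf{sub}\,\chi$ is the intersection of all subobject-closed subsets $\mathsf U\subseteq\mathsf{Sp}\,\mathsf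 C$ with $\chi\in\mathsf U$. *)

(* Defs.v *)
From HB Require Import structures.
From mathcomp Require Import all_boot all_order all_algebra.
From mathcomp Require Import all_classical topology.

Set Implicit Arguments.
Unset Strict Implicit.
Unset Printing Implicit Defensive.

Import GRing.Theory.

Local Open Scope classical_set_scope.
Local Open Scope ring_scope.

(** * Length of modules *)

(* A module over a ring A is given by an abelian group V and the action of the
   elements of A on V.  A need not carry a ring structure here: only the
   collection of submodules matters for the length. *)
Definition submodule (A : Type) (V : zmodType) (act : A -> V -> V) : set (set V) :=
  [set N | [/\ N 0, (forall u v, N u -> N v -> N (u - v))
             & forall a v, N v -> N (act a v)]].

(* 0 = F 0 < F 1 < ... < F n = V, without possible refinement, i.e. with simple
   factors F (i + 1) / F i. *)
Definition composition_series (A : Type) (V : zmodType) (act : A -> V -> V)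
    (n : nat) (F : nat -> set V) : Prop :=
  [/\ F 0%N = [set 0], F n = setT,
      (forall i, (i <= n)%N -> submodule act (F i))
    & forall i, (i < n)%N -> F i `<` F i.+1 /\
        forall N, submodule act N -> F i `<=` N -> N `<=` F i.+1 ->
          N = F i \/ N = F i.+1].

Definition has_module_length (A : Type) (V : zmodType) (act : A -> V -> V)
    (n : nat) : Prop :=
  exists F, composition_series act n F.

(* By Jordan-Hoelder at most one n satisfies has_module_length; the junk value
   for modules of infinite length is 0. *)
Definition module_length (A : Type) (V : zmodType) (act : A -> V -> V) : nat :=
  xget 0%N [set n | has_module_length act n].

(** * Linear categories *)

(* comp g f is the composite "g after f". *)
Record linCategory (k : comPzRingType) := LinCategory {
  ob :> Type;
  Mor : ob -> ob -> lmodType k;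
  idm : forall X, Mor X X;
  comp : forall X Y Z, Mor Y Z -> Mor X Y -> Mor X Z;
  comp1m : forall X Y (f : Mor X Y), comp (idm Y) f = f;
  compm1 : forall X Y (f : Mor X Y), comp f (idm X) = f;
  compA : forall W X Y Z (h : Mor Y Z) (g : Mor X Y) (f : Mor W X),
    comp h (comp g f) = comp (comp h g) f;
  comp_linearl : forall X Y Z (f : Mor X Y) (a : k) (g g' : Mor Y Z),
    comp (a *: g + g') f = a *: comp g f + comp g' f;
  comp_linearr : forall X Y Z (g : Mor Y Z) (a : k) (f f' : Mor X Y),
    comp g (a *: f + f') = a *: comp g f + comp g f'
}.

Arguments Mor {k C} X Y : rename.
Arguments idm {k C} X : rename.
Arguments comp {k C X Y Z} g f : rename.

Section Categories.
Variables (k : comPzRingType) (C : linCategory k).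
Implicit Types X Y Z : C.

Definition mono X Y (f : Mor X Y) : Prop :=
  forall W (u v : Mor W X), comp f u = comp f v -> u = v.

Definition epi X Y (f : Mor X Y) : Prop :=
  forall W (u v : Mor Y W), comp u f = comp v f -> u = v.

Definition split_mono X Y (f : Mor X Y) : Prop :=
  exists r : Mor Y X, comp r f = idm X.

Definition iso X Y (f : Mor X Y) : Prop :=
  exists g : Mor Y X, comp g f = idm X /\ comp f g = idm Y.

(* Both initial and terminal; existence of the morphisms is automatic. *)
Definition is_zero Z : Prop :=
  (forall Y (f g : Mor Z Y), f = g) /\ (forall Y (f g : Mor Y Z), f = g).

Definition is_sum X Y S : Prop :=
  exists (i : Mor X S) (j : Mor Y S) (p : Mor S X) (q : Mor S Y),
    [/\ comp p i = idm X, comp q j = idm Y, comp p j = 0, comp q i = 0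
      & comp i p + comp j q = idm S].

Definition is_kernel X Y Z (f : Mor X Y) (g : Mor Y Z) : Prop :=
  comp g f = 0 /\
  forall W (h : Mor W Y), comp g h = 0 -> exists! u : Mor W X, comp f u = h.

Definition is_cokernel X Y Z (f : Mor X Y) (g : Mor Y Z) : Prop :=
  comp g f = 0 /\
  forall W (h : Mor Y W), comp h f = 0 -> exists! u : Mor Z W, comp u g = h.

Definition abelian : Prop :=
  [/\ (exists Z, is_zero Z) /\ (forall X Y, exists S, is_sum X Y S),
      (forall Y Z (g : Mor Y Z), exists X (f : Mor X Y), is_kernel f g),
      (forall X Y (f : Mor X Y), exists Z (g : Mor Y Z), is_cokernel f g),
      (forall X Y (f : Mor X Y), mono f -> exists Z (g : Mor Y Z), is_kernel f g)
    & (forall Y Z (g : Mor Y Z), epi g -> exists X (f : Mor X Y), is_cokernel f g)].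

Definition simple_ob S : Prop :=
  ~ is_zero S /\ forall U (i : Mor U S), mono i -> is_zero U \/ iso i.

(* X admits a finite filtration with simple factors: either X = 0, or X has a
   subobject of finite length with simple quotient. *)
Inductive finite_length : C -> Prop :=
| FiniteLength0 X : is_zero X -> finite_length X
| FiniteLengthS U X S (i : Mor U X) (p : Mor X S) :
    mono i -> is_cokernel i p -> simple_ob S -> finite_length U ->
    finite_length X.

Definition abelian_length_category : Prop :=
  abelian /\ forall X, finite_length X.

Definition hom_finite : Prop :=
  forall X Y, exists n,
    has_module_length (fun (a : k) (f : Mor X Y) => a *: f) n.

Definition indecomposable X : Prop :=
  ~ is_zero X /\ forall A B, is_sum A B X -> is_zero A \/ is_zero B.

Definition left_almost_split M N (f : Mor M N) : Prop :=
  ~ split_mono f /\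
  forall N' (g : Mor M N'), ~ split_mono g -> exists h : Mor N N', comp h f = g.

(** * Characters *)

Definition character (chi : C -> nat) : Prop :=
  (forall X Y S, is_sum X Y S -> chi S = (chi X + chi Y)%N) /\
  (forall X Y Z (f : Mor X Y) (g : Mor Y Z), is_cokernel f g ->
     (chi Y <= chi X + chi Z)%N).

Definition zero_char : C -> nat := fun=> 0%N.

Definition irreducible_char (chi : C -> nat) : Prop :=
  [/\ character chi, chi <> zero_char
    & ~ exists chi1 chi2 : C -> nat,
        [/\ character chi1, character chi2, chi1 <> zero_char,
            chi2 <> zero_char & chi = (fun X => chi1 X + chi2 X)%N]].

(* The ring End(M) acts on Hom(X, M) from the left by composition. *)
Definition char_of (M : C) : C -> nat :=
  fun X => module_length (fun (a : Mor M M) (f : Mor X M) => comp a f).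

Definition finite_char (chi : C -> nat) : Prop := exists M, chi = char_of M.

Definition infinite_char (chi : C -> nat) : Prop := ~ finite_char chi.

End Categories.

(** * The space of irreducible characters *)

Definition Sp (k : comPzRingType) (C : linCategory k) : Type :=
  {chi : C -> nat | irreducible_char chi}.

HB.instance Definition _ k C := gen_eqMixin (@Sp k C).
HB.instance Definition _ k C := gen_choiceMixin (@Sp k C).

(* chi(f) = chi(X) - chi(Y) + chi(Z) with Z the cokernel of f; as characters are
   invariant under isomorphism, the choice of the cokernel does not matter. *)
Definition basic_open (k : comPzRingType) (C : linCategory k) (X Y : C)
    (f : Mor X Y) : set (Sp C) :=
  [set chi | exists (Z : C) (g : Mor Y Z), is_cokernel f g /\
     (sval chi X)%:Z - (sval chi Y)%:Z + (sval chi Z)%:Z != 0].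

(* The topology generated by the sets basic_open f.  That these sets are not
   only a subbase but a base when C is abelian is a theorem, not needed to
   define the topology. *)
HB.instance Definition _ k C := @isSubBaseTopological.Build (@Sp k C)
  (set (Sp C)) [set V | exists (X Y : C) (f : Mor X Y), V = basic_open f] id.

(** * Subobject-closed subcategories and subsets *)

Section Subcategories.
Variables (k : comPzRingType) (C : linCategory k).

Definition full_subcategory (D : set C) : linCategory k :=
  @LinCategory k {X : C | D X} (fun X Y => Mor (sval X) (sval Y))
    (fun X => idm (sval X)) (fun X Y Z g f => comp g f)
    (fun X Y => @comp1m k C (sval X) (sval Y))
    (fun X Y => @compm1 k C (sval X) (sval Y))
    (fun W X Y Z => @compA k C (sval W) (sval X) (sval Y) (sval Z))
    (fun X Y Z => @comp_linearl k C (sval X) (sval Y) (sval Z))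
    (fun X Y Z => @comp_linearr k C (sval X) (sval Y) (sval Z)).

(* Closure under isomorphism follows from the last clause. *)
Definition subobject_closed_subcat (D : set C) : Prop :=
  [/\ exists Z, is_zero Z /\ D Z,
      (forall X Y S, is_sum X Y S -> D X -> D Y -> D S)
    & (forall X Y (i : Mor X Y), mono i -> D Y -> D X)].

(* p is the object part of a left adjoint of the inclusion of D, with unit eta. *)
Definition left_adjoint_inclusion (D : set C) (p : C -> full_subcategory D) : Prop :=
  exists eta : forall X, Mor X (sval (p X)),
    forall X (Y : full_subcategory D) (f : Mor X (sval Y)),
      exists! g : Mor (p X) Y, comp (g : Mor (sval (p X)) (sval Y)) (eta X) = f.

(* The image of Sp D in Sp C under chi |-> chi o p. *)
Definition Sp_sub (D : set C) : set (Sp C) :=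
  [set psi | exists (chi : Sp (full_subcategory D)) (p : C -> full_subcategory D),
     left_adjoint_inclusion p /\ sval psi = sval chi \o p].

Definition subobject_closed (U : set (Sp C)) : Prop :=
  exists D : set C, subobject_closed_subcat D /\ U = Sp_sub D.

Definition sub_char (chi : Sp C) : set (Sp C) :=
  \bigcap_(U in [set U | subobject_closed U /\ U chi]) U.

(* Minimal with respect to inclusion among the infinite subobject-closed
   subsets of Sp C. *)
Definition minimal_infinite_subobject_closed (U : set (Sp C)) : Prop :=
  [/\ infinite_set U, subobject_closed U
    & forall V, infinite_set V -> subobject_closed V -> V `<=` U -> V = U].

End Subcategories.

(* Main.v *)
From mathcomp Require Import all_boot all_order all_algebra.
From mathcomp Require Import finmap.
From mathcomp Require Import all_classical topology.
From mathcomp Require Import zify.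
Require Import Defs.

(** A morphism [b] out of an object [X] stands for a subfunctor of Hom(X, -),
    formed by the morphisms that factor through [b].  These subfunctors form a
    modular lattice, and a character [chi] measures its intervals: the
    subquotient between [b] and [c] has length [rk chi c - rk chi b], where
    [rk chi f] is the value of [chi] at the target of [f] minus its value at the
    cokernel.  So a character is an exact length function on finitely presented
    functors, expressed here through ranks of morphisms only.

    New characters are obtained from old ones by counting only some of the
    subquotients.  A notion of weight for the steps of a chain, compatible with
    the lattice operations and with change of the object, gives an additive
    invariant, the largest weight of a chain in Hom(X, -), and this is a
    character of [X].  If the weights are bounded by the ranks of [chi], then
    the difference to [chi] is a character as well, so for irreducible [chi] the
    new character is zero or [chi] itself ([chain_char_irreducible]).  This is
    applied twice.

    Counting the steps at which new morphisms to [M] appear gives the character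
    of [M].  Let [a] be a left almost split morphism starting at [M].  If an
    irreducible [chi] does not vanish on [a], then each counted step has
    positive rank, and [chi] is the character of [M] ([irreducible_las]).  So
    finite characters are isolated points, and an infinite compact subset
    contains an infinite character.  Moreover, if [Sp_sub D] is finite, all its
    points are finite characters: the sum of its members is positive on the
    almost split morphisms starting in [D], and an induction that splits them
    off one at a time shows that a character vanishing on all of them is zero
    ([finite_Sp_sub]).  Hence an infinite character [chi] of [U] generates an
    infinite subobject-closed subset, which is [U] by minimality.

    Counting the subquotients on which every member of a set [V] of characters
    vanishes shows the following ([linked_subquotient]).  If all members of [V]
    vanish on a morphism on which the irreducible [chi] does not, then they also
    vanish on a subquotient, seen by [chi], of an image of minimal positive
    rank.  Now let [U] be minimal and generated by [chi].  If infinitely many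
    points of [U] were to vanish on such a morphism, then the subobject-closed
    subset of the points of rank zero on another morphism would contain
    infinitely many points of [U] but not [chi], against minimality
    ([basic_open_cofinite]).  Hence every neighbourhood of [chi] contains almost
    all of [U], and [U] is compact; by the first application it then contains
    an infinite character. *)

Set Implicit Arguments.
Unset Strict Implicit.
Unset Printing Implicit Defensive.

Import GRing.Theory.

Local Open Scope classical_set_scope.
Local Open Scope ring_scope.

Local Notation "g ∘ f" := (comp g f) (at level 40, left associativity) : ring_scope.

(** * Linear categories *)

Section LinearCategories.
Variables (k : comPzRingType) (C : linCategory k).
Implicit Types X Y Z W : C.

Lemma compDl X Y Z (g g' : Mor Y Z) (f : Mor X Y) :
  (g + g') ∘ f = g ∘ f + g' ∘ f.
Proof. by have := comp_linearl f 1 g g'; rewrite !scale1r. Qed.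

Lemma compDr X Y Z (g : Mor Y Z) (f f' : Mor X Y) :
  g ∘ (f + f') = g ∘ f + g ∘ f'.
Proof. by have := comp_linearr g 1 f f'; rewrite !scale1r. Qed.

Lemma comp0m X Y Z (f : Mor X Y) : (0 : Mor Y Z) ∘ f = 0.
Proof. by apply: (addIr (0 ∘ f)); rewrite -compDl !add0r. Qed.

Lemma compm0 X Y Z (g : Mor Y Z) : g ∘ (0 : Mor X Y) = 0.
Proof. by apply: (addIr (g ∘ 0)); rewrite -compDr !add0r. Qed.

Lemma compNl X Y Z (g : Mor Y Z) (f : Mor X Y) : (- g) ∘ f = - (g ∘ f).
Proof. by apply: (addIr (g ∘ f)); rewrite -compDl !addNr comp0m. Qed.

Lemma compNr X Y Z (g : Mor Y Z) (f : Mor X Y) : g ∘ (- f) = - (g ∘ f).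
Proof. by apply: (addIr (g ∘ f)); rewrite -compDr !addNr compm0. Qed.

Lemma compZl X Y Z a (g : Mor Y Z) (f : Mor X Y) : (a *: g) ∘ f = a *: (g ∘ f).
Proof. by have := comp_linearl f a g 0; rewrite comp0m !addr0. Qed.

Lemma compBl X Y Z (g g' : Mor Y Z) (f : Mor X Y) :
  (g - g') ∘ f = g ∘ f - g' ∘ f.
Proof. by rewrite compDl compNl. Qed.

Lemma compBr X Y Z (g : Mor Y Z) (f f' : Mor X Y) :
  g ∘ (f - f') = g ∘ f - g ∘ f'.
Proof. by rewrite compDr compNr. Qed.

Lemma mono0 X Y W (f : Mor X Y) (u : Mor W X) : mono f -> f ∘ u = 0 -> u = 0.
Proof. by move=> fm fu; apply: fm; rewrite fu compm0. Qed.

Lemma monoP X Y (f : Mor X Y) :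
  (forall W (u : Mor W X), f ∘ u = 0 -> u = 0) -> mono f.
Proof.
by move=> h W u v fuv; apply/subr0_eq/h; rewrite compBr fuv subrr.
Qed.

Lemma epi0 X Y W (f : Mor X Y) (u : Mor Y W) : epi f -> u ∘ f = 0 -> u = 0.
Proof. by move=> fe uf; apply: fe; rewrite uf comp0m. Qed.

Lemma epiP X Y (f : Mor X Y) :
  (forall W (u : Mor Y W), u ∘ f = 0 -> u = 0) -> epi f.
Proof.
by move=> h W u v fuv; apply/subr0_eq/h; rewrite compBl fuv subrr.
Qed.

Lemma epi_comp X Y Z (g : Mor Y Z) (f : Mor X Y) : epi g -> epi f -> epi (g ∘ f).
Proof. by move=> ge fe W u v; rewrite !compA => /fe/ge. Qed.

Lemma epi_factor X Y Z (g : Mor Y Z) (f : Mor X Y) : epi (g ∘ f) -> epi g.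
Proof. by move=> h W u v uv; apply: h; rewrite !compA uv. Qed.

Lemma mono_comp X Y Z (g : Mor Y Z) (f : Mor X Y) :
  mono g -> mono f -> mono (g ∘ f).
Proof. by move=> gm fm W u v; rewrite -!compA => /gm/fm. Qed.

Lemma split_monoW X Y (f : Mor X Y) : split_mono f -> mono f.
Proof.
case=> r rf W u v uv.
by rewrite -[u]comp1m -[v]comp1m -rf -!compA uv.
Qed.

Lemma iso_id X : iso (idm X).
Proof. by exists (idm X); rewrite comp1m. Qed.

Lemma iso_epi X Y (f : Mor X Y) : iso f -> epi f.
Proof.
by case=> g [gf fg] W u v uv; rewrite -[u]compm1 -[v]compm1 -fg !compA uv.
Qed.

Lemma iso_mono X Y (f : Mor X Y) : iso f -> mono f.
Proof. by case=> g [gf fg]; apply: split_monoW; exists g. Qed.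

Lemma iso_comp X Y Z (g : Mor Y Z) (f : Mor X Y) : iso g -> iso f -> iso (g ∘ f).
Proof.
case=> g' [g'g gg'] [f' [f'f ff']]; exists (f' ∘ g'); split.
  by rewrite compA -(compA f') g'g compm1.
by rewrite compA -(compA g) ff' compm1.
Qed.

Lemma zero_idm X : is_zero X <-> idm X = 0.
Proof.
split=> [[h _]|X0]; first exact: h.
split=> Y f g; first by rewrite -[f]compm1 -[g]compm1 X0 !compm0.
by rewrite -[f]comp1m -[g]comp1m X0 !comp0m.
Qed.

Lemma epi_to_zero X Z (f : Mor X Z) : is_zero Z -> epi f.
Proof. by case=> h _ W u v _; apply: h. Qed.

Lemma zero_split_mono X Y (f : Mor X Y) : is_zero X -> split_mono f.
Proof. by case=> h _; exists 0; apply: h. Qed.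

Lemma epi_from_zero X Y (f : Mor X Y) : is_zero X -> epi f -> is_zero Y.
Proof.
move=> [_ X0] fe; apply/zero_idm; apply: fe; rewrite comp0m comp1m.
by rewrite -[f]compm1 (X0 _ (idm X) 0) compm0.
Qed.

Lemma mono_to_zero X Y (f : Mor X Y) : is_zero Y -> mono f -> is_zero X.
Proof.
by move=> [_ Y0] fm; apply/zero_idm; apply: fm; rewrite compm0 compm1; apply: Y0.
Qed.

(** ** Cokernels and direct sums *)

Lemma cokernel_epi X Y Z (f : Mor X Y) (g : Mor Y Z) : is_cokernel f g -> epi g.
Proof.
move=> [gf univ] W u v uv.
have [|w [_ wu]] := univ _ (u ∘ g); first by rewrite -compA gf compm0.
by rewrite -(wu u) // -(wu v).
Qed.

Lemma cokernel_lift X Y Z W (f : Mor X Y) (g : Mor Y Z) (h : Mor Y W) :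
  is_cokernel f g -> h ∘ f = 0 -> exists u, u ∘ g = h.
Proof. by case=> _ univ /univ[u [uh _]]; exists u. Qed.

Lemma cokernelP X Y Z (f : Mor X Y) (g : Mor Y Z) : epi g -> g ∘ f = 0 ->
  (forall W (h : Mor Y W), h ∘ f = 0 -> exists u, u ∘ g = h) -> is_cokernel f g.
Proof.
move=> ge gf univ; split=> // W h /univ[u uh]; exists u; split=> // v vh.
by apply: ge; rewrite uh.
Qed.

Lemma kernel_mono X Y Z (f : Mor X Y) (g : Mor Y Z) : is_kernel f g -> mono f.
Proof.
move=> [gf univ]; apply: monoP => W u fu.
have [w [_ wu]] := univ W 0 (compm0 _ _).
by rewrite -(wu u) // -(wu 0) // compm0.
Qed.

Lemma kernel_lift X Y Z W (f : Mor X Y) (g : Mor Y Z) (h : Mor W Y) :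
  is_kernel f g -> g ∘ h = 0 -> exists u, f ∘ u = h.
Proof. by case=> _ univ /univ[u [uh _]]; exists u. Qed.

Lemma cokernel_to_zero X Y Z (f : Mor X Y) (g : Mor Y Z) :
  is_zero Z -> epi f -> is_cokernel f g.
Proof.
move=> Z0 fe; apply: cokernelP; first exact: epi_to_zero.
  by case: Z0 => _ h; apply: h.
by move=> W h hf; exists 0; rewrite comp0m (epi0 fe hf).
Qed.

Lemma cokernel_from_zero X Y (f : Mor X Y) : f = 0 -> is_cokernel f (idm Y).
Proof.
move=> ->; apply: cokernelP; [exact: iso_epi (iso_id Y)|exact: compm0|].
by move=> W h _; exists h; rewrite compm1.
Qed.

Lemma sum_cokernel X Y S i j p q :
  [/\ p ∘ i = idm X, q ∘ j = idm Y, p ∘ j = 0, q ∘ i = 0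
    & i ∘ p + j ∘ q = idm S] -> is_cokernel j p.
Proof.
move=> [pi qj pj qi e]; apply: cokernelP => //.
  by move=> W u v uv; rewrite -[u]compm1 -[v]compm1 -pi !compA uv.
move=> W h hj; exists (h ∘ i).
by rewrite -[RHS]compm1 -e compDr !compA hj comp0m addr0.
Qed.

Lemma sum_zero_iso X Y Z (f : Mor X Y) : is_zero Z -> iso f -> is_sum X Z Y.
Proof.
move=> Z0 [g [gf fg]]; have [_ hz] := Z0.
exists f, 0, g, 0; split=> //; try exact: hz; rewrite ?compm0 ?comp0m //.
by rewrite addr0.
Qed.

Section Characters.
Variable chi : C -> nat.
Hypothesis chiC : character chi.

Lemma char_zero Z : is_zero Z -> chi Z = 0%N.
Proof. by move=> Z0; have := chiC.1 _ _ _ (sum_zero_iso Z0 (iso_id Z)); lia. Qed.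

Lemma char_iso X Y Z (f : Mor X Y) : is_zero Z -> iso f -> chi X = chi Y.
Proof.
by move=> Z0 /(sum_zero_iso Z0) /chiC.1 ->; rewrite (char_zero Z0) addn0.
Qed.

Lemma char_epi X Y Z (f : Mor X Y) : is_zero Z -> epi f -> (chi Y <= chi X)%N.
Proof.
move=> Z0 fe; have := chiC.2 _ _ _ _ _ (cokernel_to_zero (0 : Mor Y Z) Z0 fe).
by rewrite (char_zero Z0) addn0.
Qed.

End Characters.

End LinearCategories.

(** * Abelian categories *)

Section Pushouts.
Variables (k : comPzRingType) (C : linCategory k).
Implicit Types X Y Z W P S : C.

Definition is_pushout X Y Z P (f : Mor X Y) (g : Mor X Z) (u : Mor Y P)
    (v : Mor Z P) : Prop :=
  [/\ u ∘ f = v ∘ g,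
      (forall W (h : Mor Y W) (h' : Mor Z W), h ∘ f = h' ∘ g ->
         exists w : Mor P W, w ∘ u = h /\ w ∘ v = h')
    & forall W (w w' : Mor P W), w ∘ u = w' ∘ u -> w ∘ v = w' ∘ v -> w = w'].

Lemma pushout_epi X Y Z P (f : Mor X Y) (g : Mor X Z) (u : Mor Y P) (v : Mor Z P) :
  is_pushout f g u v -> epi f -> epi v.
Proof.
move=> [uv _ uniq] fe W w w' e; apply: uniq => //.
by apply: fe; rewrite -!compA uv !compA e.
Qed.

Lemma pushout_sym X Y Z P (f : Mor X Y) (g : Mor X Z) (u : Mor Y P) (v : Mor Z P) :
  is_pushout f g u v -> is_pushout g f v u.
Proof.
move=> [uv univ uniq]; split=> // [W h h' e|W w w' e e']; last exact: uniq.
by have [w [? ?]] := univ _ _ _ (esym e); exists w.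
Qed.

Lemma pushout_cokernel_side X Y Z P K (f : Mor X Y) (g : Mor X Z) (u : Mor Y P)
    (v : Mor Z P) (c : Mor Y K) : is_pushout f g u v -> is_cokernel f c ->
  exists c' : Mor P K, [/\ c' ∘ u = c, c' ∘ v = 0 & is_cokernel v c'].
Proof.
move=> [uv univ uniq] cP; have ce := cokernel_epi cP; have [cf _] := cP.
have [|c' [cu cv]] := univ _ c 0; first by rewrite cf comp0m.
exists c'; split=> //; apply: cokernelP => //.
  by move=> W w w' e; apply: ce; rewrite -cu !compA e.
move=> W h hv; have [|s sc] := cokernel_lift (h := h ∘ u) cP.
  by rewrite -compA uv compA hv comp0m.
by exists s; apply: uniq; rewrite -!compA ?cu ?cv ?sc ?compm0.
Qed.

Lemma cokernel_comp_pushout X Y Z K P (f : Mor X Y) (g : Mor Y Z) (c : Mor Y K)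
    (u : Mor Z P) (v : Mor K P) :
  is_cokernel f c -> is_pushout g c u v -> is_cokernel (g ∘ f) u.
Proof.
move=> cP po; have [uv univ uniq] := po; have [cf _] := cP.
apply: cokernelP.
- exact: pushout_epi (pushout_sym po) (cokernel_epi cP).
- by rewrite compA uv -compA cf compm0.
move=> W h hgf; have [|s sc] := cokernel_lift (h := h ∘ g) cP.
  by rewrite -compA.
by have [w [wu _]] := univ _ _ _ (esym sc); exists w.
Qed.

Lemma pushout_cokernel_pair X Y Z P S (f : Mor X Y) (g : Mor X Z) (u : Mor Y P)
    (v : Mor Z P) (i : Mor Y S) (j : Mor Z S) (p : Mor S Y) (q : Mor S Z) :
  is_pushout f g u v ->
  [/\ p ∘ i = idm Y, q ∘ j = idm Z, p ∘ j = 0, q ∘ i = 0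
    & i ∘ p + j ∘ q = idm S] ->
  is_cokernel (i ∘ f + j ∘ g) (u ∘ p - v ∘ q).
Proof.
move=> [uv univ uniq] [pi qj pj qi e].
have ui : (u ∘ p - v ∘ q) ∘ i = u.
  by rewrite compBl -!compA pi qi compm0 subr0 compm1.
have uj : (u ∘ p - v ∘ q) ∘ j = - v.
  by rewrite compBl -!compA pj qj compm0 sub0r compm1.
apply: cokernelP.
- move=> W w w' ww; apply: uniq; first by rewrite -ui !compA ww.
  by apply: oppr_inj; rewrite -!compNr -uj !compA ww.
- by rewrite compDr !compA ui uj uv compNl subrr.
move=> W h; rewrite compDr !compA => /eqP; rewrite addr_eq0 => /eqP.
rewrite -(compNl _ g) => e'; have [w [wu wv]] := univ _ _ _ e'; exists w.
by rewrite compBr !compA wu wv compNl opprK -!compA -compDr e compm1.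
Qed.

End Pushouts.

Section Abelian.
Variables (k : comPzRingType) (C : linCategory k).
Hypothesis abC : abelian C.
Implicit Types X Y Z W P S : C.

Lemma zero_ex : exists Z : C, is_zero Z.
Proof. by case: abC => [[]]. Qed.

Definition zob : C := projT1 (cid zero_ex).

Lemma zobP : is_zero zob.
Proof. exact: projT2 (cid zero_ex). Qed.

Lemma sum_ex X Y : exists S, is_sum X Y S.
Proof. by case: abC => [[]]. Qed.

Lemma kernel_ex Y Z (g : Mor Y Z) : exists X (f : Mor X Y), is_kernel f g.
Proof. by case: abC. Qed.

Lemma cokernel_ex X Y (f : Mor X Y) : exists Z (g : Mor Y Z), is_cokernel f g.
Proof. by case: abC. Qed.

Definition cok X Y (f : Mor X Y) : C := projT1 (cid (cokernel_ex f)).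
Definition cokm X Y (f : Mor X Y) : Mor Y (cok f) :=
  projT1 (cid (projT2 (cid (cokernel_ex f)))).

Lemma cokP X Y (f : Mor X Y) : is_cokernel f (cokm f).
Proof. exact: projT2 (cid (projT2 (cid (cokernel_ex f)))). Qed.

Lemma pushout_ex X Y Z (f : Mor X Y) (g : Mor X Z) :
  exists P (u : Mor Y P) (v : Mor Z P), is_pushout f g u v.
Proof.
have [S [i [j [p [q [pi qj pj qi e]]]]]] := sum_ex Y Z.
have [P [c cP]] := cokernel_ex (i ∘ f - j ∘ g).
exists P, (c ∘ i), (c ∘ j); split.
- have [c0 _] := cP; apply/eqP; rewrite -subr_eq0 -!compA -compBr; exact/eqP.
- move=> W h h' hh.
  have hi : (h ∘ p + h' ∘ q) ∘ i = h.
    by rewrite compDl -!compA pi qi compm0 compm1 addr0.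
  have hj : (h ∘ p + h' ∘ q) ∘ j = h'.
    by rewrite compDl -!compA pj qj compm0 compm1 add0r.
  have [|w wc] := cokernel_lift (h := h ∘ p + h' ∘ q) cP.
    by rewrite compBr !compA hi hj hh subrr.
  by exists w; rewrite !compA wc.
move=> W w w' wi wj; apply: (cokernel_epi cP).
rewrite -[LHS]compm1 -[RHS]compm1 -e !compDr !compA.
by move: wi wj; rewrite !compA => -> ->.
Qed.

Lemma mono_epi_iso X Y (f : Mor X Y) : mono f -> epi f -> iso f.
Proof.
move=> fm fe; have [_ _ _ /(_ _ _ _ fm)[Z [g fg]] _] := abC.
have [gf _] := fg; have g0 := epi0 fe gf.
have [|u fu] := kernel_lift (h := idm Y) fg; first by rewrite g0 comp0m.
exists u; split=> //; apply: fm.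
by rewrite compA fu comp1m compm1.
Qed.

Lemma epi_cokernel X Y Z (f : Mor X Y) (g : Mor Y Z) :
  epi g -> is_kernel f g -> is_cokernel f g.
Proof.
move=> ge fg; have [_ _ _ _ /(_ _ _ _ ge)[W [h hP]]] := abC.
have [gf _] := fg; have [gh _] := hP.
have [t ft] := kernel_lift fg gh.
apply: cokernelP => // V s sf; apply: (cokernel_lift hP).
by rewrite -ft compA sf comp0m.
Qed.

Lemma mono_kernel X Y Z (f : Mor X Y) (g : Mor Y Z) :
  mono f -> is_cokernel f g -> is_kernel f g.
Proof.
move=> fm fg; have [_ _ _ /(_ _ _ _ fm)[W [h fh]] _] := abC.
have [gf _] := fg; have [hf _] := fh.
have [t tg] := cokernel_lift fg hf.
split=> // V s gs.
have [|u fu] := kernel_lift (h := s) fh; first by rewrite -tg -compA gs compm0.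
by exists u; split=> // v fv; apply: fm; rewrite fu.
Qed.

(** The object in the middle is the coimage, the cokernel [e] of the kernel of
    [f].  If the induced [m] kills [u] and [q] is the cokernel of [u], then the
    kernel of [q ∘ e] is killed by [f], hence by [e]; so [e] factors through
    [q ∘ e], which splits [q] and forces [u = 0]. *)
Lemma image_factorization X Y (f : Mor X Y) :
  exists I (e : Mor X I) (m : Mor I Y), [/\ epi e, mono m & m ∘ e = f].
Proof.
have [K [i ker]] := kernel_ex f; have [I [e eP]] := cokernel_ex i.
have [fi _] := ker; have [m me] := cokernel_lift eP fi.
have ee := cokernel_epi eP.
exists I, e, m; split=> //; apply: monoP => W u mu.
have [Q [q qP]] := cokernel_ex u.
have qe := epi_comp (cokernel_epi qP) ee.
have [_ _ _ _ /(_ _ _ _ qe)[L [l lP]]] := abC.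
have [m' m'q] := cokernel_lift qP mu; have [qel _] := lP.
have [|t it] := kernel_lift (h := l) ker.
  by rewrite -me -m'q -(compA m') -compA qel compm0.
have [|s sq] := cokernel_lift (h := e) lP.
  by have [ei _] := eP; rewrite -it compA ei comp0m.
have sq1 : s ∘ q = idm I by apply: ee; rewrite -compA sq comp1m.
by have [qu _] := qP; rewrite -[u]comp1m -sq1 -compA qu compm0.
Qed.

(** ** Rank functions *)

(** The length, as measured by [chi], of the image of the natural transformation
    Hom(Y, -) -> Hom(X, -) induced by [f]. *)
Definition rk (chi : C -> nat) X Y (f : Mor X Y) : nat :=
  (chi Y - chi (cok f))%N.

Section Rank.
Variable chi : C -> nat.
Hypothesis chiC : character chi.

Lemma char_cokernel X Y Z Z' (f : Mor X Y) (g : Mor Y Z) (g' : Mor Y Z') :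
  is_cokernel f g -> is_cokernel f g' -> chi Z = chi Z'.
Proof.
move=> gP gP'.
have [u ug] := cokernel_lift gP (proj1 gP').
have [v vg] := cokernel_lift gP' (proj1 gP).
apply/eqP; rewrite eqn_leq; apply/andP; split; apply: (char_epi chiC zobP).
  by apply: (@epi_factor _ _ _ _ _ v g'); rewrite vg; apply: cokernel_epi gP.
by apply: (@epi_factor _ _ _ _ _ u g); rewrite ug; apply: cokernel_epi gP'.
Qed.

Lemma char_le X Y (f : Mor X Y) : epi f -> (chi Y <= chi X)%N.
Proof. exact: (char_epi chiC zobP). Qed.

Lemma rk_cokernel X Y Z (f : Mor X Y) (g : Mor Y Z) : is_cokernel f g ->
  (rk chi f + chi Z)%N = chi Y.
Proof.
move=> gP; rewrite /rk (char_cokernel (cokP f) gP) subnK //.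
exact: char_le (cokernel_epi gP).
Qed.

Lemma rk_source X Y (f : Mor X Y) : (rk chi f <= chi X)%N.
Proof. by have := chiC.2 _ _ _ _ _ (cokP f); have := rk_cokernel (cokP f); lia. Qed.

Lemma rk_epi X Y (f : Mor X Y) : epi f -> rk chi f = chi Y.
Proof.
move=> fe; have := rk_cokernel (cokernel_to_zero (0 : Mor Y zob) zobP fe).
by rewrite (char_zero chiC zobP) addn0.
Qed.

Lemma rk_idm X : rk chi (idm X) = chi X.
Proof. exact/rk_epi/iso_epi/iso_id. Qed.

Lemma rk_zero X Y : rk chi (0 : Mor X Y) = 0%N.
Proof. by have := rk_cokernel (cokernel_from_zero (erefl (0 : Mor X Y))); lia. Qed.

(** The cokernel of the pairing of [g] with the cokernel of [f] is the pushout
    of these two morphisms, and this is the cokernel of [g ∘ f] as well.  Most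
    properties of the rank (it drops under composition, it is transported along
    a cokernel) are consequences. *)
Lemma rk_comp_pair X Y Z K S (f : Mor X Y) (g : Mor Y Z) (c : Mor Y K)
    (i : Mor Z S) (j : Mor K S) (p : Mor S Z) (q : Mor S K) :
  is_cokernel f c ->
  [/\ p ∘ i = idm Z, q ∘ j = idm K, p ∘ j = 0, q ∘ i = 0
    & i ∘ p + j ∘ q = idm S] ->
  (rk chi (g ∘ f) + chi Y)%N = (rk chi f + rk chi (i ∘ g + j ∘ c))%N.
Proof.
move=> cP sP; have [P [u [v po]]] := pushout_ex g c.
have := rk_cokernel (cokernel_comp_pushout cP po).
have := rk_cokernel (pushout_cokernel_pair po sP).
have := rk_cokernel cP.
have -> : chi S = (chi Z + chi K)%N by apply: chiC.1; exists i, j, p, q.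
lia.
Qed.

Lemma rk_comp_le X Y Z (g : Mor Y Z) (f : Mor X Y) :
  (rk chi (g ∘ f) <= rk chi f)%N.
Proof.
have [S [i [j [p [q sP]]]]] := sum_ex Z (cok f).
have := rk_comp_pair g (cokP f) sP; have := rk_source (i ∘ g + j ∘ cokm f).
lia.
Qed.

Lemma rk_pushout_pair X Y Z P S (f : Mor X Y) (g : Mor X Z) (u : Mor Y P)
    (v : Mor Z P) (i : Mor Y S) (j : Mor Z S) (p : Mor S Y) (q : Mor S Z) :
  is_pushout f g u v ->
  [/\ p ∘ i = idm Y, q ∘ j = idm Z, p ∘ j = 0, q ∘ i = 0
    & i ∘ p + j ∘ q = idm S] ->
  (rk chi (i ∘ f + j ∘ g) + rk chi v)%N = (rk chi f + chi Z)%N.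
Proof.
move=> po sP; have [c' [_ _ cP']] := pushout_cokernel_side po (cokP f).
have := rk_cokernel cP'; have := rk_cokernel (cokP f).
have := rk_cokernel (pushout_cokernel_pair po sP).
have -> : chi S = (chi Y + chi Z)%N by apply: chiC.1; exists i, j, p, q.
lia.
Qed.

(** Dividing a pushout by the image of its source leaves the direct sum of the
    cokernels of the two legs. *)
Lemma char_cokernel_pushout X Y Z P K L Q (f : Mor X Y) (g : Mor X Z)
    (u : Mor Y P) (v : Mor Z P) (c : Mor Y K) (d : Mor Z L) (e : Mor P Q) :
  is_pushout f g u v -> is_cokernel f c -> is_cokernel g d ->
  is_cokernel (v ∘ g) e -> chi Q = (chi K + chi L)%N.
Proof.
move=> po cP dP eP; have [uv _ uniq] := po.
have [p' [p'u p'v _]] := pushout_cokernel_side po cP.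
have [q' [q'v q'u _]] := pushout_cokernel_side (pushout_sym po) dP.
have [p pe] : exists p, p ∘ e = p'.
  by apply: (cokernel_lift eP); rewrite compA p'v comp0m.
have [q qe] : exists q, q ∘ e = q'.
  by apply: (cokernel_lift eP); rewrite -uv compA q'u comp0m.
have [ev _] := eP.
have [i ic] : exists i, i ∘ c = e ∘ u.
  by apply: (cokernel_lift cP); rewrite -compA uv.
have [j jd] : exists j, j ∘ d = e ∘ v.
  by apply: (cokernel_lift dP); rewrite -compA.
apply: chiC.1; exists i, j, p, q; split.
- by apply: (cokernel_epi cP); rewrite -compA ic compA pe comp1m.
- by apply: (cokernel_epi dP); rewrite -compA jd compA qe comp1m.
- by apply: (cokernel_epi dP); rewrite -compA jd compA pe comp0m.
- by apply: (cokernel_epi cP); rewrite -compA ic compA qe comp0m.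
apply: (cokernel_epi eP); rewrite compDl -!compA pe qe comp1m.
apply: uniq; rewrite !compDl -!compA ?p'u ?q'u ?p'v ?q'v ?ic ?jd.
  by rewrite compm0 addr0.
by rewrite compm0 add0r.
Qed.

End Rank.

End Abelian.

(** * The modular lattice of morphisms out of an object *)

(** A morphism out of [X], standing for the subfunctor of Hom(X, -) of all
    morphisms that factor through it.  With primitive projections a morphism
    and its package determine each other up to conversion. *)
#[projections(primitive)]
Record under (k : comPzRingType) (C : linCategory k) (X : C) : Type :=
  Under { cod : C; arr : Mor X cod }.

Arguments Under {k C X cod} arr.

Definition under_le (k : comPzRingType) (C : linCategory k) (X : C)
    (b c : under X) : Prop :=
  exists t : Mor (cod c) (cod b), arr b = t ∘ arr c.

Local Notation "b ⊑ c" := (under_le b c) (at level 70) : ring_scope.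

Definition pull (k : comPzRingType) (C : linCategory k) (X Y : C) (f : Mor X Y)
    (b : under Y) : under X := Under (arr b ∘ f).

Section Under.
Variables (k : comPzRingType) (C : linCategory k).
Hypothesis abC : abelian C.
Implicit Types X Y Z : C.

Definition ubot X : under X := Under (0 : Mor X (zob abC)).
Definition utop X : under X := Under (idm X).

Lemma ule_refl X (b : under X) : b ⊑ b.
Proof. by exists (idm _); rewrite comp1m. Qed.

Lemma ule_trans X (c b d : under X) : b ⊑ c -> c ⊑ d -> b ⊑ d.
Proof. by case=> t bt [s cs]; exists (t ∘ s); rewrite bt cs compA. Qed.

Lemma ule_bot X (b : under X) : ubot X ⊑ b.
Proof. by exists 0; rewrite comp0m. Qed.

Lemma ule_top X (b : under X) : b ⊑ utop X.
Proof. by exists (arr b); rewrite compm1. Qed.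

Lemma ule_pull X Y (f : Mor X Y) (b c : under Y) : b ⊑ c -> pull f b ⊑ pull f c.
Proof. by case=> t e; exists t; rewrite /= e compA. Qed.

Lemma pull_le X Y (f : Mor X Y) (b : under Y) : pull f b ⊑ Under f.
Proof. by exists (arr b). Qed.

Lemma ule_add X N (h h' : Mor X N) (b : under X) :
  Under h ⊑ b -> Under h' ⊑ b -> Under (h + h') ⊑ b.
Proof. by case=> t /= ht [t' /= ht']; exists (t + t'); rewrite /= ht ht' compDl. Qed.

Lemma ule_opp X N (h : Mor X N) (b : under X) : Under h ⊑ b -> Under (- h) ⊑ b.
Proof. by case=> t /= ht; exists (- t); rewrite /= ht compNl. Qed.

Lemma ule_comp X N N' (u : Mor N N') (h : Mor X N) (b : under X) :
  Under h ⊑ b -> Under (u ∘ h) ⊑ b.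
Proof. by case=> t /= ht; exists (u ∘ t); rewrite /= ht compA. Qed.

Lemma rk_le (chi : C -> nat) X (b c : under X) : character chi -> b ⊑ c ->
  (rk abC chi (arr b) <= rk abC chi (arr c))%N.
Proof. by move=> chiC [t ->]; apply: rk_comp_le. Qed.

Lemma rk_equiv (chi : C -> nat) X (b c : under X) : character chi ->
  b ⊑ c -> c ⊑ b -> rk abC chi (arr b) = rk abC chi (arr c).
Proof. by move=> chiC bc cb; apply/eqP; rewrite eqn_leq !rk_le. Qed.

Definition is_meet X (b x m : under X) : Prop :=
  [/\ m ⊑ b, m ⊑ x & forall h, h ⊑ b -> h ⊑ x -> h ⊑ m].

(** The last clause says that the join is the sum of two subfunctors computed
    on each object. *)
Definition is_join X (b x j : under X) : Prop :=
  [/\ b ⊑ j, x ⊑ j, (forall h, b ⊑ h -> x ⊑ h -> j ⊑ h)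
    & forall N (h : Mor X N), Under h ⊑ j ->
        exists h1 h2, [/\ h = h1 + h2, Under h1 ⊑ b & Under h2 ⊑ x]].

Lemma pair_join X Y Z S (f : Mor X Y) (g : Mor X Z) (i : Mor Y S) (j : Mor Z S)
    (p : Mor S Y) (q : Mor S Z) :
  [/\ p ∘ i = idm Y, q ∘ j = idm Z, p ∘ j = 0, q ∘ i = 0
    & i ∘ p + j ∘ q = idm S] ->
  is_join (Under f) (Under g) (Under (i ∘ f + j ∘ g)).
Proof.
move=> [pi qj pj qi e]; split.
- exists p; rewrite /= compDr !compA pi pj comp0m addr0 comp1m //.
- exists q; rewrite /= compDr !compA qi qj comp0m add0r comp1m //.
- move=> h [s /= hs] [t /= ht]; exists (i ∘ s + j ∘ t).
  by rewrite /= hs ht compDl !compA.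
move=> N h [s /= ->]; exists (s ∘ i ∘ f), (s ∘ j ∘ g); split.
- by rewrite compDr !compA.
- by exists (s ∘ i).
- by exists (s ∘ j).
Qed.

(** The meet is the diagonal of the pushout, the join the pairing into the
    direct sum.  The cokernel of the pairing is the pushout, so the ranks of
    meet and join add up to those of the two morphisms. *)
Lemma lattice_ex X (b x : under X) : exists mj : under X * under X,
  [/\ is_meet b x mj.1, is_join b x mj.2 & forall chi, character chi ->
   (rk abC chi (arr mj.1) + rk abC chi (arr mj.2) =
    rk abC chi (arr b) + rk abC chi (arr x))%N].
Proof.
have [P [u [v po]]] := pushout_ex abC (arr b) (arr x).
have [S [i [j [p [q sP]]]]] := sum_ex abC (cod b) (cod x).
exists (Under (v ∘ arr x), Under (i ∘ arr b + j ∘ arr x)); split=> /=.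
- have [uv univ _] := po; split; first by exists u; rewrite /= uv.
    by exists v.
  move=> h [s sb] [t tx]; have [|w [wu wv]] := univ _ s t; first by rewrite -sb.
  by exists w; rewrite /= tx compA wv.
- exact (pair_join (arr b) (arr x) sP).
move=> chi chiC; have := rk_cokernel abC chiC (pushout_cokernel_pair po sP).
have := char_cokernel_pushout chiC po (cokP abC _) (cokP abC _) (cokP abC _).
have := rk_cokernel abC chiC (cokP abC (arr b)).
have := rk_cokernel abC chiC (cokP abC (arr x)).
have := rk_cokernel abC chiC (cokP abC (v ∘ arr x)).
have -> : chi S = (chi (cod b) + chi (cod x))%N.
  by apply: chiC.1; exists i, j, p, q.
lia.
Qed.

Definition umeet X (b x : under X) : under X := (projT1 (cid (lattice_ex b x))).1.
Definition ujoin X (b x : under X) : under X := (projT1 (cid (lattice_ex b x))).2.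

Lemma umeetP X (b x : under X) : is_meet b x (umeet b x).
Proof. by have [] := projT2 (cid (lattice_ex b x)). Qed.

Lemma ujoinP X (b x : under X) : is_join b x (ujoin b x).
Proof. by have [] := projT2 (cid (lattice_ex b x)). Qed.

Lemma rk_modular (chi : C -> nat) X (b x : under X) : character chi ->
  (rk abC chi (arr (umeet b x)) + rk abC chi (arr (ujoin b x)) =
   rk abC chi (arr b) + rk abC chi (arr x))%N.
Proof. by have [_ _] := projT2 (cid (lattice_ex b x)); apply. Qed.

Lemma umeet_le X (b c x : under X) : b ⊑ c -> umeet b x ⊑ umeet c x.
Proof.
move=> bc; have [_ _ h] := umeetP c x; have [b1 b2 _] := umeetP b x.
by apply: h => //; apply: ule_trans bc.
Qed.

Lemma ujoin_le X (b c x : under X) : b ⊑ c -> ujoin b x ⊑ ujoin c x.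
Proof.
move=> bc; have [_ _ h _] := ujoinP b x; have [c1 c2 _ _] := ujoinP c x.
by apply: h => //; apply: ule_trans c1.
Qed.

(** The kernel of the map Hom(Y, -) -> Hom(X, -) given by [f] is the image of
    Hom(Z, -), where [c] is a cokernel of [f].  Hence precomposition with [f]
    identifies the interval above [c] with the interval below [f]. *)
Section Transport.
Variables (X Y Z : C) (f : Mor X Y) (c : Mor Y Z).
Hypothesis cP : is_cokernel f c.

Lemma pull_reflect (a b : under Y) : Under c ⊑ b -> pull f a ⊑ pull f b -> a ⊑ b.
Proof.
move=> [t /= tb] [u /= e].
have [|s sc] := cokernel_lift (h := arr a - u ∘ arr b) cP.
  by rewrite compBl e compA subrr.
exists (s ∘ t + u); rewrite compDl -compA -tb sc subrK //.
Qed.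

(** A morphism below [f] extends along [f], but its extension need not lie
    above [c]; adding [c] as a second component repairs this and changes
    nothing after precomposition with [f]. *)
Lemma pull_lift (b : under X) : b ⊑ Under f ->
  exists B : under Y, [/\ Under c ⊑ B, pull f B ⊑ b & b ⊑ pull f B].
Proof.
move=> [t /= tb]; have [S [i [j [p [q sP]]]]] := sum_ex abC (cod b) Z.
have [tj cj _ _] := pair_join t c sP; have [pi qj pj qi e] := sP.
exists (Under (i ∘ t + j ∘ c)); split=> //.
  exists i; rewrite /= compDl -!compA -tb.
  by have [-> _] := cP; rewrite compm0 addr0.
case: tj => p' /= p't; exists p'; rewrite /= compA -p't //.
Qed.

Lemma rk_pull (chi : C -> nat) (b : under Y) : character chi -> Under c ⊑ b ->
  rk abC chi (arr b) = (rk abC chi (arr (pull f b)) + chi Z)%N.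
Proof.
move=> chiC cb; have [S [i [j [p [q sP]]]]] := sum_ex abC (cod b) Z.
have := rk_comp_pair abC chiC (arr b) cP sP; have := rk_cokernel abC chiC cP.
suff -> : rk abC chi (i ∘ arr b + j ∘ c) = rk abC chi (arr b) by rewrite /=; lia.
have [bj cj jl _] := pair_join (arr b) c sP.
apply: (@rk_equiv chi Y (Under (i ∘ arr b + j ∘ c)) b chiC).
  by apply: jl => //; apply: ule_refl.
exact: bj.
Qed.

End Transport.

(** * Characters from chains of subquotients *)

(** A relation [W X b c w] allows the weight [w] on the step from [b] to [c].
    The conditions make the largest total weight of a chain an additive
    invariant of finitely presented functors: [weight_modular] lets a chain be
    refined through any further subfunctor [x] without loss of weight, and
    [weight_pull] makes the weight depend on the subquotient alone. *)
Record weight (W : forall X, under X -> under X -> nat -> Prop) : Prop := {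
  weight0 : forall X (b c : under X), b ⊑ c -> W X b c 0%N;
  weight_equiv : forall X (b b' c c' : under X) w,
    b ⊑ b' -> b' ⊑ b -> c ⊑ c' -> c' ⊑ c -> W X b c w -> W X b' c' w;
  weight_modular : forall X (b c x : under X) w, b ⊑ c -> W X b c w ->
    exists w1 w2, [/\ W X (umeet b x) (umeet c x) w1,
      W X (ujoin b x) (ujoin c x) w2 & (w <= w1 + w2)%N];
  weight_pull : forall X Y Z (f : Mor X Y) (c : Mor Y Z), is_cokernel f c ->
    forall (a b : under Y) w, Under c ⊑ a -> a ⊑ b ->
    (W X (pull f a) (pull f b) w <-> W Y a b w) }.

Section Chains.
Variable W : forall X, under X -> under X -> nat -> Prop.
Hypothesis wW : weight W.

Inductive chain X (a : under X) : under X -> nat -> Prop :=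
| chain_nil : chain a a 0
| chain_step b c n w : chain a b n -> b ⊑ c -> W b c w -> chain a c (n + w).

Lemma chain_le X (a b : under X) n : chain a b n -> a ⊑ b.
Proof.
by elim=> [|b' c n' w _ ab bc _]; [exact: ule_refl|exact: ule_trans bc].
Qed.

Lemma chain0 X (a b : under X) : a ⊑ b -> chain a b 0.
Proof. by move=> ab; apply: (chain_step (chain_nil a) ab (weight0 wW ab)). Qed.

Lemma chain_cat X (b a c : under X) n m :
  chain a b n -> chain b c m -> chain a c (n + m).
Proof.
move=> ab; elim=> [|d e m' w _ ih de wde]; first by rewrite addn0.
by rewrite addnA; apply: chain_step ih de wde.
Qed.

Lemma chain_widen X (a a' b b' : under X) n :
  a' ⊑ a -> b ⊑ b' -> chain a b n -> chain a' b' n.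
Proof.
move=> aa bb ab; rewrite -[n]addn0 -[n]add0n.
exact: chain_cat (chain_cat (chain0 aa) ab) (chain0 bb).
Qed.

(** Schreier refinement: a chain is met and joined with [x]. *)
Lemma chain_refine X (a x c : under X) n : chain a c n -> a ⊑ x -> x ⊑ c ->
  exists n1 n2, [/\ chain a x n1, chain x c n2 & (n <= n1 + n2)%N].
Proof.
move=> acn ax xc.
suff [n1 [n2 [h1 h2 le]]] : exists n1 n2, [/\ chain (umeet a x) (umeet c x) n1,
    chain (ujoin a x) (ujoin c x) n2 & (n <= n1 + n2)%N].
  have [_ h3 _] := umeetP c x; have [_ _ h4] := umeetP a x.
  have [_ h5 _ _] := ujoinP a x; have [_ _ h6 _] := ujoinP c x.
  exists n1, n2; split=> //.
    exact: chain_widen (h4 _ (ule_refl a) ax) h3 h1.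
  exact: chain_widen h5 (h6 _ (ule_refl c) xc) h2.
elim: acn {xc} => [|b d n' w _ [n1 [n2 [h1 h2 le]]] bd wbd].
  by exists 0%N, 0%N; split=> //; apply: chain_nil.
have [w1 [w2 [hw1 hw2 lew]]] := weight_modular wW x bd wbd.
exists (n1 + w1)%N, (n2 + w2)%N; split; last by lia.
  exact: chain_step h1 (umeet_le x bd) hw1.
exact: chain_step h2 (ujoin_le x bd) hw2.
Qed.

Section ChainTransport.
Variables (X Y Z : C) (f : Mor X Y) (c : Mor Y Z).
Hypothesis cP : is_cokernel f c.

Lemma chain_pull (a b : under Y) n : Under c ⊑ a -> chain a b n ->
  chain (pull f a) (pull f b) n.
Proof.
move=> ca; elim=> [|b' d n' w h ih bd wbd]; first exact: chain_nil.
apply: (chain_step ih (ule_pull f bd)).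
exact/(weight_pull wW cP _ (ule_trans ca (chain_le h)) bd).
Qed.

Lemma chain_lift (b : under X) n : chain (ubot X) b n -> b ⊑ Under f ->
  chain (Under c) (utop Y) n.
Proof.
move=> h bf; suff [B [cB _ _ hB]] : exists B, [/\ Under c ⊑ B, pull f B ⊑ b,
    b ⊑ pull f B & chain (Under c) B n].
  exact: chain_widen (ule_refl _) (ule_top B) hB.
elim: h bf => [_|a d n' w had ih ad wad df].
  exists (Under c); split; first exact: ule_refl; last exact: chain_nil.
    by have [cf _] := cP; exists 0; rewrite /= cf comp0m.
  exact: ule_bot.
have [A [cA Aa aA hA]] := ih (ule_trans ad df).
have [D [cD Dd dD]] := pull_lift cP df.
have AD : A ⊑ D.
  by apply: (pull_reflect cP cD); apply: ule_trans Aa (ule_trans ad dD).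
exists D; split=> //; apply: (chain_step hA AD).
apply/(weight_pull wW cP _ cA AD).
exact: (weight_equiv wW aA Aa dD Dd wad).
Qed.

End ChainTransport.

Definition max_chain X (a b : under X) (n : nat) : Prop :=
  chain a b n /\ forall m, chain a b m -> (m <= n)%N.

(** By [chain_valP] this value is attained as soon as the weights of the chains
    are bounded; without a bound it is the junk value 0. *)
Definition chain_val X (a b : under X) : nat := xget 0%N [set n | max_chain a b n].

Definition chain_char X : nat := chain_val (ubot X) (utop X).

Hypothesis bounded : forall X, exists B, forall n,
  chain (ubot X) (utop X) n -> (n <= B)%N.

Lemma chain_valP X (a b : under X) : a ⊑ b -> max_chain a b (chain_val a b).
Proof.
move=> ab; have [B hB] := bounded X.
pose P n := `[< chain a b n >].
have P0 : exists n, P n by exists 0%N; apply/asboolP; exact: chain0.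
have PB n : P n -> (n <= B)%N.
  move=> /asboolP h; apply: hB; exact: chain_widen (ule_bot a) (ule_top b) h.
have [n /asboolP h1 h2] := ex_maxnP P0 PB.
rewrite /chain_val; case: xgetP => [m -> //|/(_ n)]; case; split=> // m h.
exact/h2/asboolP.
Qed.

Lemma chain_val_uniq X (a b : under X) n : max_chain a b n -> chain_val a b = n.
Proof.
move=> [h1 h2]; have [h3 h4] := chain_valP (chain_le h1).
by apply/eqP; rewrite eqn_leq h2 // h4.
Qed.

Lemma chain_val_add X (a b c : under X) : a ⊑ b -> b ⊑ c ->
  chain_val a c = (chain_val a b + chain_val b c)%N.
Proof.
move=> ab bc; have [h1 m1] := chain_valP ab; have [h2 m2] := chain_valP bc.
apply: chain_val_uniq; split; first exact: chain_cat h1 h2.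
move=> m hm; have [n1 [n2 [/m1 c1 /m2 c2 le]]] := chain_refine hm ab bc.
by apply: (leq_trans le); apply: leq_add.
Qed.

Lemma chain_val_top X Y Z (f : Mor X Y) (c : Mor Y Z) : is_cokernel f c ->
  chain_val (Under c) (utop Y) = chain_val (ubot X) (Under f).
Proof.
move=> cP; have [h m] := chain_valP (ule_bot (Under f)).
apply: chain_val_uniq; split.
  exact (chain_lift cP h (ule_refl (Under f))).
move=> m' /(chain_pull cP (ule_refl _)) h'; apply: m.
apply: chain_widen h'; first exact: ule_bot.
exact: pull_le.
Qed.

(** Hom(Y, -) has the subfunctor Hom(Z, -), and the quotient is the image of
    Hom(Y, -) in Hom(X, -). *)
Lemma chain_char_cokernel X Y Z (f : Mor X Y) (c : Mor Y Z) : is_cokernel f c ->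
  chain_char Y = (chain_char Z + chain_val (ubot X) (Under f))%N.
Proof.
move=> cP; rewrite /chain_char (chain_val_add (ule_bot (Under c)) (ule_top _)).
rewrite (chain_val_top cP); congr addn; apply/esym.
have cP' := cokernel_to_zero (0 : Mor Z (zob abC)) (zobP abC) (cokernel_epi cP).
exact: chain_val_top cP'.
Qed.

Lemma chain_char_source X Y (f : Mor X Y) :
  chain_char X =
  (chain_val (ubot X) (Under f) + chain_val (Under f) (utop X))%N.
Proof. exact: chain_val_add (ule_bot _) (ule_top _). Qed.

(** In the subadditivity, the difference of the two sides is the weight between
    [f] and the top of the lattice at [X]. *)
Lemma chain_char_character : character chain_char.
Proof.
split=> [X Y S [i [j [p [q sP]]]]|X Y Z f g gP].
  rewrite (chain_char_cokernel (sum_cokernel sP)); congr addn.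
  have [_ qj _ _ _] := sP; rewrite (chain_char_source j).
  suff -> : chain_val (Under j) (utop Y) = 0%N by rewrite addn0.
  have jY : utop Y ⊑ Under j by exists q; rewrite /= qj.
  have [h1 m1] := chain_valP (ule_bot (Under j)).
  have [h2 m2] := chain_valP (ule_top (Under j)).
  have := m1 _ (chain_widen (ule_refl _) jY (chain_cat h1 h2)); lia.
by rewrite (chain_char_cokernel gP) (chain_char_source f); lia.
Qed.

End Chains.

Arguments chain_nil {W X a}.

(** ** Weights bounded by the ranks of a character *)

Section Dominated.
Variable W : forall X, under X -> under X -> nat -> Prop.
Hypothesis wW : weight W.
Variable chi : C -> nat.
Hypothesis chiC : character chi.
Hypothesis dom : forall X (b c : under X) w, b ⊑ c -> W b c w ->
  (w + rk abC chi (arr b) <= rk abC chi (arr c))%N.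

Lemma chain_rk X (a b : under X) n : chain W a b n ->
  (n + rk abC chi (arr a) <= rk abC chi (arr b))%N.
Proof. by elim=> [|b' c n' w _ ih /dom h /h]; lia. Qed.

Lemma dominated_bounded X : exists B, forall n,
  chain W (ubot X) (utop X) n -> (n <= B)%N.
Proof.
exists (chi X) => n /chain_rk /=.
by rewrite (rk_idm abC chiC); apply: leq_trans; apply: leq_addr.
Qed.

Lemma chain_val_rk X (a b : under X) : a ⊑ b ->
  (chain_val W a b + rk abC chi (arr a) <= rk abC chi (arr b))%N.
Proof. by move=> /(chain_valP wW dominated_bounded)[/chain_rk]. Qed.

Lemma chain_char_le X : (chain_char W X <= chi X)%N.
Proof.
have := chain_val_rk (ule_top (ubot X)); rewrite /= (rk_idm abC chiC) /chain_char.
lia.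
Qed.

Lemma chain_char_dominated : character (chain_char W).
Proof. exact: chain_char_character wW dominated_bounded. Qed.

(** The rank of [chi] and the weight are both additive along the interval above
    [f], and the weight is the smaller one. *)
Lemma chain_char_complement : character (fun X => chi X - chain_char W X)%N.
Proof.
split=> [X Y S s|X Y Z f g gP].
  rewrite (chiC.1 _ _ _ s) (chain_char_dominated.1 _ _ _ s).
  by have := chain_char_le X; have := chain_char_le Y; lia.
have := chain_char_cokernel wW dominated_bounded gP.
have := chain_char_source wW dominated_bounded f.
have := chain_val_rk (ule_top (Under f)); rewrite /= (rk_idm abC chiC).
have := rk_cokernel abC chiC gP.
have := chain_char_le X; have := chain_char_le Y; have := chain_char_le Z.
lia.
Qed.

Lemma chain_char_irreducible : irreducible_char chi ->
  chain_char W = @zero_char k C \/ chain_char W = chi.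
Proof.
move=> [_ _ irr].
have [|n0] := EM (chain_char W = @zero_char k C); first by left.
right; apply: contrapT => nchi; apply: irr.
exists (chain_char W), (fun X => chi X - chain_char W X)%N; split=> //.
- exact: chain_char_dominated.
- exact: chain_char_complement.
- move=> e; apply: nchi; apply/funext => X.
  by have := congr1 (fun F => F X) e; have := chain_char_le X; rewrite /zero_char /=; lia.
by apply/funext => X; rewrite subnKC // chain_char_le.
Qed.

End Dominated.

End Under.

(** * Chains of submodules *)

Section Modules.
Variables (A : Type) (V : zmodType) (act : A -> V -> V).
Hypothesis actD : forall a u v, act a (u + v) = act a u + act a v.

Inductive schain (M : set V) : set V -> nat -> Prop :=
| schain_nil : schain M M 0
| schain_step N P n : schain M N n -> submodule act P -> N `<` P ->
    schain M P n.+1.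

Lemma submodule0 : submodule act [set 0].
Proof.
have act0 a : act a 0 = 0 by apply: (addIr (act a 0)); rewrite -actD !add0r.
by split=> // [u v -> ->|a v ->]; rewrite ?subr0 /= ?act0.
Qed.

Lemma submoduleT : submodule act setT.
Proof. by []. Qed.

Lemma submoduleD M u v : submodule act M -> M u -> M v -> M (u + v).
Proof.
move=> [M0 MB _] Mu Mv; rewrite -[v]opprK; apply: (MB) => //.
by rewrite -sub0r; apply: MB.
Qed.

Lemma submodule_sum M N : submodule act M -> submodule act N ->
  submodule act [set w | exists u v, [/\ M u, N v & w = u + v]].
Proof.
move=> [M0 MB Ma] [N0 NB Na]; split.
- by exists 0, 0; rewrite addr0.
- move=> _ _ [u [v [Mu Nv ->]]] [u' [v' [Mu' Nv' ->]]].
  exists (u - u'), (v - v'); split; [exact: MB|exact: NB|].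
  by rewrite opprD addrACA.
- move=> a _ [u [v [Mu Nv ->]]]; exists (act a u), (act a v).
  by split; [exact: Ma|exact: Na|exact: actD].
Qed.

Lemma submoduleI M N : submodule act M -> submodule act N ->
  submodule act (M `&` N).
Proof.
move=> [M0 MB Ma] [N0 NB Na]; split=> //.
  by move=> u v [? ?] [? ?]; split; [exact: MB|exact: NB].
by move=> a v [? ?]; split; [exact: Ma|exact: Na].
Qed.

Lemma schain_submodule M N n : submodule act M -> schain M N n -> submodule act N.
Proof. by move=> Ms; case. Qed.

(** Intersecting a chain below [P] with a maximal submodule [N] of [P] costs
    at most one step, since the chain leaves [N] only once. *)
Lemma schain_maximal N P : submodule act N -> submodule act P -> N `<=` P ->
  (forall Q, submodule act Q -> N `<=` Q -> Q `<=` P -> Q = N \/ Q = P) ->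
  forall L M n, submodule act L -> schain L M n -> M `<=` P ->
  exists m, schain (L `&` N) (M `&` N) m /\
    ((n <= m)%N \/ (n <= m.+1)%N /\ ~ (M `<=` N)).
Proof.
move=> Ns Ps NP maxN L M n Ls; elim=> [|M' Q n' h ih Qs [MQ QM] QP].
  by exists 0%N; split; [exact: schain_nil|left].
have [|m [hm cases]] := ih; first exact: subset_trans QP.
have Ms := schain_submodule Ls h.
have sub : M' `&` N `<=` Q `&` N by move=> u [/MQ].
have grow : ~ (Q `&` N `<=` M') -> exists m', schain (L `&` N) (Q `&` N) m' /\ m' = m.+1.
  move=> nsub; exists m.+1; split=> //; apply: (schain_step hm); first exact: submoduleI.
  by split=> // /(_ _ _) qm; apply: nsub => u /qm[].
have [MN|MN] := EM (M' `<=` N).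
  have le : (n' <= m)%N by case: cases => // [[_]].
  have [QN|QN] := EM (Q `<=` N).
    have [|m' [h' e]] := grow; last by exists m'; split=> //; left; lia.
    by move=> qn; apply: QM => u Qu; apply: qn; split=> //; exact: QN.
  have [e|ne] := EM (M' `&` N = Q `&` N).
    by exists m; rewrite -e; split=> //; right; split=> //; lia.
  have [|m' [h' e]] := grow; last by exists m'; split=> //; left; lia.
  move=> qn; apply: ne; apply/seteqP; split=> // u [Qu Nu].
  by split=> //; apply: qn.
have [|m' [h' e]] := grow; last first.
  exists m'; split=> //; right; split; last by move=> QN; apply: MN; exact: subset_trans QN.
  by case: cases => [|[]]; lia.
move=> qn; apply: QM => d Qd.
have NS : N `<=` [set w | exists u v, [/\ M' u, N v & w = u + v]].
  by move=> v Nv; exists 0, v; rewrite add0r; split=> //; case: Ms.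
have SP : [set w | exists u v, [/\ M' u, N v & w = u + v]] `<=` P.
  move=> _ [u [v [Mu Nv ->]]]; apply: (submoduleD Ps); first exact/QP/MQ.
  exact: NP.
have [/seteqP[sN _]|e] := maxN _ (submodule_sum Ms Ns) NS SP.
  case: MN => u Mu; apply: sN; exists u, 0; rewrite addr0; split=> //.
  by case: Ns.
have : P d by exact: QP.
rewrite -e => -[u [v [Mu Nv dE]]]; rewrite dE; apply: (submoduleD Ms) => //.
apply: qn; split=> //; have -> : v = d - u by rewrite dE addrC addKr.
by case: Qs => _ QB _; apply: QB => //; apply: MQ.
Qed.

(** Half of the Jordan-Hoelder theorem: no chain is longer than a composition
    series. *)
Lemma composition_series_bound n F : composition_series act n F ->
  forall i, (i <= n)%N -> forall L M m, submodule act L -> schain L M m ->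
  M `<=` F i -> (m <= i)%N.
Proof.
move=> [F0 Fn Fs Fmax]; elim=> [_|i ih lt] L M m Ls.
  rewrite F0; case=> // N P m' h Ps [NP PN] P0; case: PN => u /P0 ->.
  by have [] := schain_submodule Ls h.
move=> h MF; have [[FF _] maxF] := Fmax _ lt.
have [m' [h' cases]] :=
  schain_maximal (Fs _ (ltnW lt)) (Fs _ lt) FF maxF Ls h MF.
have IL := submoduleI Ls (Fs _ (ltnW lt)).
have := ih (ltnW lt) _ _ _ IL h' (@subIsetr _ _ _).
by case: cases => [|[]]; lia.
Qed.

Lemma composition_series_schain n F : composition_series act n F ->
  schain [set 0] setT n.
Proof.
move=> [F0 <- Fs Fmax].
suff H i : (i <= n)%N -> schain [set 0] (F i) i by exact: H.
elim: i => [_|i ih lt]; first by rewrite F0; exact: schain_nil.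
by apply: (schain_step (ih (ltnW lt)) (Fs _ lt)); case: (Fmax _ lt).
Qed.

Lemma has_length_max n : has_module_length act n ->
  schain [set 0] setT n /\ forall m, schain [set 0] setT m -> (m <= n)%N.
Proof.
move=> [F FP]; split; first exact: composition_series_schain FP.
move=> m h; have [_ Fn _ _] := FP.
by apply: (composition_series_bound FP (leqnn n) submodule0 h); rewrite Fn.
Qed.

Lemma schain_fun L M n : submodule act L -> schain L M n -> exists F : nat -> set V,
  [/\ F 0%N = L, F n = M, (forall i, (i <= n)%N -> submodule act (F i))
    & forall i, (i < n)%N -> F i `<` F i.+1].
Proof.
move=> Ls; elim=> [|N P m h [F [F0 Fm Fs Fl]] Ps NP].
  by exists (fun=> L).
exists (fun i => if (i <= m)%N then F i else P); split=> //.
- by rewrite ltnn.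
- by move=> i _; case: ifP => // /Fs.
move=> i; rewrite ltnS => im; rewrite im; case: ltnP => [lt|mi]; first exact: Fl.
have -> : i = m by lia.
by rewrite Fm.
Qed.

Lemma has_length_of_bound B :
  (forall n, schain [set 0] setT n -> (n <= B)%N) ->
  exists n, has_module_length act n.
Proof.
move=> hB; pose Q n := `[< schain [set 0] setT n >].
have Q0 : exists n, Q n.
  have [e|ne] := EM ([set 0 : V] = setT).
    by exists 0%N; apply/asboolP; rewrite -e; apply: schain_nil.
  exists 1%N; apply/asboolP; apply: (schain_step (schain_nil _) submoduleT).
  by split=> // h; apply: ne; apply/seteqP.
have QB n : Q n -> (n <= B)%N by move=> /asboolP; apply: hB.
have [n /asboolP hn mx] := ex_maxnP Q0 QB.
have {}mx m : schain [set 0] setT m -> (m <= n)%N by move=> h; apply/mx/asboolP.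
have [F [F0 Fn Fs Fl]] := schain_fun submodule0 hn.
exists n, F; split=> // i lt; split; first exact: Fl.
move=> N Ns FN NF; apply: contrapT => /not_orP[n1 n2].
suff : schain [set 0] setT n.+1 by move=> /mx; rewrite ltnn.
have below j : (j <= n)%N -> schain [set 0] (F j) j.
  elim: j => [_|j ih lj]; first by rewrite F0; exact: schain_nil.
  exact: schain_step (ih (ltnW lj)) (Fs _ lj) (Fl _ lj).
rewrite -Fn; suff above j : (i < j)%N -> (j <= n)%N -> schain [set 0] (F j) j.+1.
  exact: above.
elim: j => [//|j ih]; rewrite ltnS leq_eqVlt => /orP[/eqP e|ij] jn; last first.
  exact: schain_step (ih ij (ltnW jn)) (Fs _ jn) (Fl _ jn).
subst j; have NFs : N `<` F i.+1.
  by split=> // FiN; apply: n2; apply/seteqP.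
have FNs : F i `<` N by split=> // NFi; apply: n1; apply/seteqP.
exact: schain_step (schain_step (below _ (ltnW jn)) Ns FNs) (Fs _ jn) NFs.
Qed.

End Modules.

(** * The characters of objects *)

Lemma schain_weaken (A A' : Type) (V : zmodType) (act : A -> V -> V)
    (act' : A' -> V -> V) : (forall N, submodule act N -> submodule act' N) ->
  forall M N n, schain act M N n -> schain act' M N n.
Proof.
move=> sub M N n; elim=> [|N' P n' _ ih /sub Ps NP]; first exact: schain_nil.
exact: schain_step ih Ps NP.
Qed.

Section HomWeight.
Variables (k : comPzRingType) (C : linCategory k).
Hypothesis abC : abelian C.
Hypothesis finC : hom_finite C.
Variable M : C.
Implicit Types X Y Z : C.

(** The steps counted are those at which the value of the subfunctor at [M]
    grows. *)
Definition hom_weight X (b c : under X) (w : nat) : Prop :=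
  w = 0%N \/ w = 1%N /\ exists h : Mor X M, Under h ⊑ c /\ ~ Under h ⊑ b.

Lemma hom_weightP : weight abC hom_weight.
Proof.
split.
- by move=> X b c _; left.
- move=> X b b' c c' w bb b'b cc c'c [->|[-> [h [hc hb]]]]; [by left|right].
  split=> //; exists h; split; first exact: ule_trans cc.
  by move=> hb'; apply: hb; apply: ule_trans b'b.
- move=> X b c x w bc [->|[-> [h [hc hb]]]].
    by exists 0%N, 0%N; split=> //; left.
  have [hj|nhj] := EM (Under h ⊑ ujoin abC b x); last first.
    exists 0%N, 1%N; split=> //; [by left|right]; split=> //; exists h.
    by split=> //; have [cj _ _ _] := ujoinP abC c x; apply: ule_trans cj.
  have [_ _ _ /(_ _ _ hj)[h1 [h2 [e hb1 hx2]]]] := ujoinP abC b x.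
  exists 1%N, 0%N; split=> //; [right|by left]; split=> //; exists h2; split.
    have [_ _ mm] := umeetP abC c x; apply: mm => //.
    have -> : h2 = h + - h1 by rewrite e addrC addKr.
    by apply: ule_add => //; apply: ule_opp; apply: ule_trans bc.
  have [mb _ _] := umeetP abC b x; move=> hm; apply: hb; rewrite e.
  by apply: ule_add => //; apply: ule_trans mb.
move=> X Y Z f c cP a b w ca ab; split; case=> [->|[-> [h [hb ha]]]]; try by left.
  right; split=> //; case: hb => t /= ht; exists (t ∘ arr b).
  split; first by exists t.
  by move=> /(ule_pull f) hta; apply: ha; case: hta => s /= hs; exists s; rewrite /= -hs ht compA.
right; split=> //; exists (h ∘ f); split; first exact: ule_pull f _ _ hb.
move=> hfa; apply: ha.
exact (pull_reflect cP (a := Under h) ca hfa).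
Qed.

Definition hom_act X (a : Mor M M) (f : Mor X M) : Mor X M := a ∘ f.

Lemma hom_actD X (a : Mor M M) (f g : Mor X M) :
  hom_act a (f + g) = hom_act a f + hom_act a g.
Proof. exact: compDr. Qed.

Definition hom_ev X (b : under X) : set (Mor X M) := [set h | Under h ⊑ b].

Lemma hom_ev_submodule X (b : under X) : submodule (@hom_act X) (hom_ev b).
Proof.
split=> [|u v ub vb|a u ub].
- by exists 0; rewrite comp0m.
- by apply: ule_add => //; apply: ule_opp.
- exact: ule_comp.
Qed.

Lemma chain_schain X (b c : under X) n : chain hom_weight b c n ->
  exists m, (n <= m)%N /\ schain (@hom_act X) (hom_ev b) (hom_ev c) m.
Proof.
elim=> [|c' d n' w _ [m [le h]] cd wd].
  by exists 0%N; split=> //; apply: schain_nil.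
have sub : hom_ev c' `<=` hom_ev d by move=> u uc; apply: ule_trans cd.
case: wd => [->|[-> [u [ud uc]]]].
  have [e|ne] := EM (hom_ev c' = hom_ev d).
    by exists m; rewrite -e addn0.
  exists m.+1; split; first by rewrite addn0 ltnW.
  apply: schain_step h (hom_ev_submodule _) _; split=> // sub'.
  by apply: ne; apply/seteqP.
exists m.+1; split; first by rewrite addn1.
by apply: schain_step h (hom_ev_submodule _) _; split=> // /(_ u ud).
Qed.

(** A chain of submodules is realised by morphisms out of [X] by adding, at
    each step, one new element as a further component. *)
Lemma schain_chain X (N : set (Mor X M)) n : schain (@hom_act X) [set 0] N n ->
  exists b : under X, chain hom_weight (ubot abC X) b n /\ hom_ev b `<=` N.
Proof.
elim=> [|N' P m _ [b [h bN]] Ps [NP PN]].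
  exists (ubot abC X); split; first exact: chain_nil.
  by move=> u [t /= ->]; rewrite compm0.
have [g [Pg Ng]] : exists g, P g /\ ~ N' g.
  apply: contrapT => ne; apply: PN => g Pg; apply: contrapT => Ng.
  by apply: ne; exists g.
have [bj gj _ jE] := ujoinP abC b (Under g).
exists (ujoin abC b (Under g)); split.
  rewrite -addn1; apply: (chain_step h bj); right; split=> //; exists g.
  by split=> // /bN.
move=> u /jE[h1 [h2 [-> /bN/NP P1 [t /= ->]]]].
apply: (submoduleD Ps) => //.
by case: Ps => _ _ /(_ t g Pg).
Qed.

Lemma hom_length_max X n : has_module_length (@hom_act X) n ->
  max_chain hom_weight (ubot abC X) (utop X) n.
Proof.
move=> /(has_length_max (@hom_actD X))[h mx]; split.
  have [b [hb _]] := schain_chain h.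
  exact (chain_widen hom_weightP (ule_refl _) (ule_top b) hb).
move=> m /chain_schain[m' [le h']]; apply: (leq_trans le); apply: mx.
have <- : hom_ev (ubot abC X) = [set 0].
  apply/seteqP; split=> [u [t /= ->]|u ->]; first by rewrite compm0.
  by exists 0; rewrite comp0m.
have <- // : hom_ev (utop X) = setT.
by apply/seteqP; split=> // u _; apply: ule_top.
Qed.

Lemma hom_length_ex X : exists n, has_module_length (@hom_act X) n.
Proof.
have [B hB] := finC X M; apply: (@has_length_of_bound _ _ _ (@hom_actD X) B).
have [|_ mx] := has_length_max _ hB; first by move=> a u v; rewrite scalerDr.
move=> n h; apply: mx; apply: schain_weaken h => N [N0 NB Na]; split=> // a v Nv.
have -> : a *: v = hom_act (a *: idm M) v by rewrite /hom_act compZl comp1m.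
exact: Na.
Qed.

Lemma hom_weight_bounded X : exists B, forall n,
  chain hom_weight (ubot abC X) (utop X) n -> (n <= B)%N.
Proof. by have [n /hom_length_max[_ h]] := hom_length_ex X; exists n. Qed.

(** Evaluation at [M] turns chains of subfunctors of Hom(X, -) into chains of
    End(M)-submodules of Hom(X, M), and [schain_chain] goes back.  Finite length
    over the base ring gives finite length over End(M). *)
Lemma char_ofE : char_of M = chain_char abC hom_weight.
Proof.
apply/funext => X; rewrite /char_of /module_length.
case: xgetP => [n _ nP|nP]; last by have [n /nP] := hom_length_ex X.
apply/esym/(chain_val_uniq hom_weightP hom_weight_bounded).
exact: hom_length_max.
Qed.

Lemma char_of_character : character (char_of M).
Proof. rewrite char_ofE; exact: chain_char_character hom_weightP hom_weight_bounded. Qed.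

End HomWeight.

(** * Noetherian induction *)

Section Noetherian.
Variables (k : comPzRingType) (C : linCategory k).
Hypothesis abC : abelian C.
Implicit Types X Y Z U S : C.

Definition proper_quotient Y X : Prop := exists e : Mor X Y, epi e /\ ~ iso e.

Lemma acc_quotient X Y (e : Mor X Y) :
  Acc proper_quotient X -> epi e -> Acc proper_quotient Y.
Proof.
move=> aX ee; have [[r [re er]]|ni] := EM (iso e); last first.
  by apply: (Acc_inv aX); exists e.
constructor=> Z [q [qe ni]]; apply: (Acc_inv aX); exists (q ∘ e); split.
  exact: epi_comp.
move=> ie; apply: ni; rewrite -[q]compm1 -er compA; apply: iso_comp => //.
by exists e.
Qed.

Lemma simple_quotient S Z (e : Mor S Z) : simple_ob S -> epi e ->
  is_zero Z \/ iso e.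
Proof.
move=> [_ simpS] ee; have [K [i kP]] := kernel_ex abC e; have [ei _] := kP.
have [K0|ii] := simpS _ _ (kernel_mono kP).
  right; apply: (mono_epi_iso abC) => //; apply: monoP => W u eu.
  have [v <-] := kernel_lift kP eu.
  by case: K0 => h _; rewrite (h _ i 0) comp0m.
left; apply/zero_idm; apply: ee; rewrite comp1m comp0m.
exact: (epi0 (iso_epi ii) ei).
Qed.

(** Extending an object by a simple one keeps proper quotients well-founded: a
    proper quotient of the middle term [X] either is a quotient of [U], or is
    an extension of a proper quotient of [U] by a simple object. *)
Lemma acc_extension U X S (i : Mor U X) (p : Mor X S) :
  Acc proper_quotient U -> mono i -> is_cokernel i p -> simple_ob S ->
  Acc proper_quotient X.
Proof.
move=> aU; elim: aU X S i p => {}U aU ih X S i p im ipP simpS.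
constructor=> X1 [e [ee ni]].
have [Z [c cP]] := cokernel_ex abC (e ∘ i); have [cei _] := cP.
have [t tp] : exists t, t ∘ p = c ∘ e by apply: (cokernel_lift ipP); rewrite -compA.
have ce := cokernel_epi cP.
have te : epi t by apply: (@epi_factor _ _ _ _ _ t p); rewrite tp; apply: epi_comp.
(* The quotient of [X1] by the image of [U] is a quotient of [S]. *)
have [Z0|it] := simple_quotient simpS te.
  apply: (@acc_quotient U X1 (e ∘ i)); first by constructor.
  apply: epiP => W u uei; have [v <-] := cokernel_lift cP uei.
  by case: Z0 => h _; rewrite (h _ v 0) comp0m.
have [I [e' [m [e'e mm me]]]] := image_factorization abC (e ∘ i).
have cmP : is_cokernel m c.
  apply: cokernelP => //; first by apply: (epi0 e'e); rewrite -compA me.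
  by move=> W h hm; apply: (cokernel_lift cP); rewrite -me compA hm comp0m.
have simpZ : simple_ob Z.
  have [t' [t't tt']] := it; have [nS simp] := simpS; split.
    by move=> Z0; apply: nS; apply: (mono_to_zero Z0 (iso_mono it)).
  move=> V j jm; have [|V0|ij] := simp _ (t' ∘ j); [|by left|right].
    by apply: mono_comp => //; apply: iso_mono; exists t.
  by rewrite -[j]comp1m -tt' -compA; apply: iso_comp.
have [ie'|ne'] := EM (iso e'); last by apply: ih mm cmP simpZ; exists e'.
(* If the image of [U] is [U] and the quotient is [S], then [e] has no kernel. *)
case: ni; apply: (mono_epi_iso abC) => //; apply: monoP => W u eu.
have pu : p ∘ u = 0.
  by apply: (mono0 (iso_mono it)); rewrite compA tp -compA eu compm0.
have [v iv] := kernel_lift (mono_kernel abC im ipP) pu.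
have v0 : v = 0.
  apply: (mono0 (mono_comp mm (iso_mono ie'))).
  by rewrite me -compA iv.
by rewrite -iv v0 compm0.
Qed.

Lemma finite_length_acc X : finite_length X -> Acc proper_quotient X.
Proof.
elim=> [{}X X0|U {}X S i p im pP simpS _ aU]; last exact: acc_extension aU im pP simpS.
constructor=> Y [e [ee []]]; exists 0; have [h _] := X0.
by have [h' _] := epi_from_zero X0 ee; split; [apply: h|apply: h'].
Qed.

Lemma sum_proper_quotient A B X : is_sum A B X -> ~ is_zero A -> ~ is_zero B ->
  proper_quotient A X /\ proper_quotient B X.
Proof.
move=> [i [j [p [q [pi qj pj qi e]]]]] nA nB.
have split_epi Z (r : Mor X Z) s : r ∘ s = idm Z -> epi r.
  by move=> rs W u v uv; rewrite -[u]compm1 -[v]compm1 -rs !compA uv.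
split; [exists p|exists q]; (split; first by [apply: split_epi pi|apply: split_epi qj]).
  move=> ip; apply: nB; apply/zero_idm.
  by rewrite -qj (mono0 (iso_mono ip) pj) compm0.
move=> iq; apply: nA; apply/zero_idm.
by rewrite -pi (mono0 (iso_mono iq) qi) compm0.
Qed.

Lemma decomposable X : ~ is_zero X -> ~ indecomposable X ->
  exists A B, [/\ is_sum A B X, ~ is_zero A & ~ is_zero B].
Proof.
move=> nX nind; apply: contrapT => nex; apply: nind; split=> // A B s.
apply: contrapT => /not_orP[nA nB]; apply: nex; by exists A, B.
Qed.

Lemma indecomposable_summand X : Acc proper_quotient X -> ~ is_zero X ->
  exists M (s : Mor M X), indecomposable M /\ split_mono s.
Proof.
elim=> {}X _ ih nX; have [iX|nind] := EM (indecomposable X).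
  by exists X, (idm X); split=> //; exists (idm X); rewrite comp1m.
have [A [B [s nA nB]]] := decomposable nX nind.
have [qA _] := sum_proper_quotient s nA nB.
have [M [t [iM [r rt]]]] := ih A qA nA.
have [i [j [p [q [pi _ _ _ _]]]]] := s.
exists M, (i ∘ t); split=> //; exists (r ∘ p).
by rewrite -compA (compA p) pi comp1m.
Qed.

End Noetherian.

(** * Characters of indecomposable objects *)

Section AlmostSplit.
Variables (k : comPzRingType) (C : linCategory k).
Hypothesis abC : abelian C.
Hypothesis finC : hom_finite C.
Implicit Types X Y Z M N : C.

(** If [h : X -> M] factors through [c] but not through [b], then the pushout
    of [b] along [h] is a morphism out of [M] that is not a split monomorphism,
    so it factors through [a] and its rank is smaller than [chi M].  By
    [rk_pushout_pair] this deficiency is the gain in rank on adding [h] to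
    [b]. *)
Lemma hom_weight_rk M N (a : Mor M N) (chi : C -> nat) :
  left_almost_split a -> character chi -> (rk abC chi a < chi M)%N ->
  forall X (b c : under X) w, b ⊑ c -> hom_weight M b c w ->
  (w + rk abC chi (arr b) <= rk abC chi (arr c))%N.
Proof.
move=> [_ las] chiC lt X b c w bc [->|[-> [h [hc hb]]]]; first exact: rk_le.
have [P [u [v po]]] := pushout_ex abC (arr b) h; have [uv _ _] := po.
have [S [i [j [p [q sP]]]]] := sum_ex abC (cod b) M.
have [|t ta] := las _ v.
  move=> [r rv]; apply: hb; exists (r ∘ u).
  by rewrite /= -compA uv compA rv comp1m.
have [_ _ jl _] := pair_join (arr b) h sP.
have := rk_le abC chiC (jl c bc hc); rewrite /=.
have := rk_pushout_pair abC chiC po sP.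
have := rk_comp_le abC chiC t a; rewrite ta.
lia.
Qed.

Lemma char_of_defect M X Y (f : Mor X Y) (h : Mor X M) :
  ~ Under h ⊑ Under f -> (rk abC (char_of M) f < char_of M X)%N.
Proof.
move=> nh; have wM := hom_weightP abC M.
have bM := hom_weight_bounded abC finC M.
have := rk_cokernel abC (char_of_character abC finC M) (cokP abC f).
rewrite (char_ofE abC finC M).
rewrite (chain_char_cokernel wM bM (cokP abC f)) (chain_char_source wM bM f).
have [_ mx] := chain_valP wM bM (ule_top (Under f)).
have : (1 <= chain_val (hom_weight M) (Under f) (utop X))%N.
  apply: mx; apply: (chain_step (n := 0)) (ule_top _) _; first exact: chain_nil.
  by right; split=> //; exists h; split=> //; apply: ule_top.
lia.
Qed.

Lemma char_of_no_defect M X Y (f : Mor X Y) :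
  (forall h : Mor X M, Under h ⊑ Under f) ->
  rk abC (char_of M) f = char_of M X.
Proof.
move=> all_f; have wM := hom_weightP abC M.
have bM := hom_weight_bounded abC finC M.
have := rk_cokernel abC (char_of_character abC finC M) (cokP abC f).
rewrite (char_ofE abC finC M).
rewrite (chain_char_cokernel wM bM (cokP abC f)) (chain_char_source wM bM f).
have [h _] := chain_valP wM bM (ule_top (Under f)).
suff : chain_val (hom_weight M) (Under f) (utop X) = 0%N by lia.
elim: h => [//|b c n w fb -> bc [->//|[_ [h [_ hb]]]]].
by case: hb; apply: ule_trans (all_f h) (chain_le fb).
Qed.

Lemma char_of_las M N (a : Mor M N) : left_almost_split a ->
  (rk abC (char_of M) a < char_of M M)%N.
Proof.
move=> [ns _]; apply: (char_of_defect (h := idm M)) => -[t /= e].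
by apply: ns; exists t.
Qed.

Lemma char_of_le M N (a : Mor M N) (chi : C -> nat) :
  left_almost_split a -> character chi -> (rk abC chi a < chi M)%N ->
  forall X, (char_of M X <= chi X)%N.
Proof.
move=> las chiC lt X; rewrite (char_ofE abC finC M).
exact: (chain_char_le (hom_weightP abC M) chiC (hom_weight_rk las chiC lt)).
Qed.

(** By [hom_weight_rk] counting morphisms to [M] yields a subcharacter of [chi],
    which is not zero. *)
Lemma irreducible_las M N (a : Mor M N) (chi : C -> nat) :
  left_almost_split a -> irreducible_char chi -> (rk abC chi a < chi M)%N ->
  chi = char_of M.
Proof.
move=> las irr lt; have [chiC _ _] := irr.
have := chain_char_irreducible (hom_weightP abC M) chiC (hom_weight_rk las chiC lt) irr.
rewrite -(char_ofE abC finC M) => -[e|//].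
by have := char_of_las las; rewrite e.
Qed.

Lemma rk_add (chi chi' : C -> nat) X Y (f : Mor X Y) :
  character chi -> character chi' ->
  rk abC (fun X => chi X + chi' X)%N f = (rk abC chi f + rk abC chi' f)%N.
Proof.
move=> c c'; rewrite /rk; have := rk_cokernel abC c (cokP abC f).
have := rk_cokernel abC c' (cokP abC f); lia.
Qed.

(** In a sum of two characters one summand does not vanish on [a], hence
    dominates the character of [M] and leaves nothing for the other. *)
Lemma char_of_irreducible M N (a : Mor M N) : left_almost_split a ->
  irreducible_char (char_of M).
Proof.
move=> las; have pos := char_of_las las; split.
- exact: char_of_character.
- by move=> e; rewrite e in pos.
move=> [c1 [c2 [C1 C2 n1 n2 e]]].
have leM c : character c -> (rk abC c a < c M)%N -> forall X, (c1 X + c2 X <= c X)%N.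
  by move=> cC lt X; have := char_of_le las cC lt X; rewrite e.
have [lt|ge] := ltnP (rk abC c1 a) (c1 M).
  by apply: n2; apply/funext => X; have := leM _ C1 lt X; rewrite /zero_char; lia.
apply: n1; apply/funext => X; rewrite /zero_char.
suff lt : (rk abC c2 a < c2 M)%N by have := leM _ C2 lt X; lia.
by move: pos; rewrite e (rk_add a C1 C2); lia.
Qed.

End AlmostSplit.

(** * Subobject-closed subcategories *)

Section Reflections.
Variables (k : comPzRingType) (C : linCategory k).
Hypothesis abC : abelian C.
Implicit Types X Y Z N : C.

Definition reflection (D : set C) X X' (e : Mor X X') : Prop :=
  [/\ D X', epi e & forall N (f : Mor X N), D N -> exists g, g ∘ e = f].

Definition reflective (D : set C) : Prop :=
  forall X, exists X' (e : Mor X X'), reflection D e.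

Definition fixes (D : set C) (chi : C -> nat) : Prop :=
  forall X, exists X' (e : Mor X X'), reflection D e /\ chi X = chi X'.

Lemma fixes_reflective D chi : fixes D chi -> reflective D.
Proof. by move=> h X; have [X' [e [re _]]] := h X; exists X', e. Qed.

(** It suffices to see one quotient in [D] with the same value, since the
    reflection lies above it. *)
Lemma fixesP D (chi : C -> nat) : character chi -> reflective D ->
  (forall X, exists X' (e : Mor X X'), [/\ D X', epi e & chi X = chi X']) ->
  fixes D chi.
Proof.
move=> chiC rD h X; have [X' [r rP]] := rD X; have [_ re univ] := rP.
exists X', r; split=> //.
have [X'' [e [DX ee eq]]] := h X; have [g ge] := univ _ e DX.
have gg : epi g by apply: (@epi_factor _ _ _ _ _ g r); rewrite ge.
by have := char_le abC chiC gg; have := char_le abC chiC re; lia.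
Qed.

Section Functor.
Variables (D : set C) (p : C -> full_subcategory D).
Variable eta : forall X, Mor X (sval (p X)).
Hypothesis etaP : forall X, reflection D (eta X).

Lemma reflection_mor X Y (f : Mor X Y) :
  exists g : Mor (sval (p X)) (sval (p Y)), g ∘ eta X = eta Y ∘ f.
Proof. by have [_ _ univ] := etaP X; apply: univ; apply: (svalP (p Y)). Qed.

Lemma reflection_char (c : full_subcategory D -> nat) :
  character c -> character (c \o p).
Proof.
have eta_epi X : epi (eta X) by case: (etaP X).
move=> cC; split=> [X Y S [i [j [q [r [qi rj qj ri e]]]]]|X Y Z f g fg] /=.
  have [i' hi] := reflection_mor i; have [j' hj] := reflection_mor j.
  have [q' hq] := reflection_mor q; have [r' hr] := reflection_mor r.
  apply: cC.1; exists i', j', q', r'; split=> /=; apply: eta_epi.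
  - by rewrite -compA hi compA hq -compA qi comp1m compm1.
  - by rewrite -compA hj compA hr -compA rj comp1m compm1.
  - by rewrite -compA hj compA hq -compA qj compm0 comp0m.
  - by rewrite -compA hi compA hr -compA ri compm0 comp0m.
  rewrite compDl -!compA hq hr !compA hi hj -!compA -compDr e.
  by rewrite comp1m compm1.
have [f' hf] := reflection_mor f; have [g' hg] := reflection_mor g.
apply: (cC.2 _ _ _ f' g'); have [gf _] := fg; split.
  by apply: eta_epi; rewrite /= -compA hf compA hg -compA gf compm0 comp0m.
move=> W h hf0; have [|u ug] := cokernel_lift (h := (h : Mor (sval (p Y)) (sval W)) ∘ eta Y) fg.
  by rewrite -compA -hf compA; move: hf0 => /= ->; rewrite comp0m.
have [_ _ univ] := etaP Z; have [u' hu] := univ _ u (svalP W).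
exists u'; split=> [|v vg] /=.
  by apply: eta_epi; rewrite -compA hg compA hu ug.
apply: eta_epi; rewrite hu; apply: (cokernel_epi fg).
by rewrite ug -compA -hg compA; move: vg => /= ->.
Qed.

Lemma restrict_char (psi : C -> nat) : character psi ->
  (forall X, psi X = psi (sval (p X))) ->
  character (fun Y : full_subcategory D => psi (sval Y)).
Proof.
move=> psiC fx; split=> [X Y S|X Y Z f g fg]; first exact: psiC.1.
have [K [c cP]] := cokernel_ex abC f; have [gf univ] := fg.
have [|u [ug _]] := univ (p K) (eta K ∘ c).
  by rewrite /= -compA; have [-> _] := cP; rewrite compm0.
have [_ eK _] := etaP K.
have := epi_comp eK (cokernel_epi cP); rewrite -ug.
move=> /(@epi_factor k C (sval Y) (sval Z) (sval (p K)) u g) ue.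
by have := char_le abC psiC ue; have := psiC.2 _ _ _ _ _ cP; rewrite (fx K); lia.
Qed.

(** A decomposition of the restriction is pulled back along the reflection to a
    decomposition of [psi]. *)
Lemma restrict_irreducible (psi : C -> nat) : irreducible_char psi ->
  (forall X, psi X = psi (sval (p X))) ->
  irreducible_char (fun Y : full_subcategory D => psi (sval Y)).
Proof.
move=> [psiC n0 irr] fx; split; first exact: restrict_char.
  move=> e; apply: n0; apply/funext => X; rewrite fx.
  exact: (congr1 (fun F => F (p X)) e).
move=> [c1 [c2 [C1 C2 n1 n2 e]]]; apply: irr.
have D0 : exists Z : full_subcategory D, is_zero Z.
  exists (p (zob abC)); apply/zero_idm; rewrite /=; apply/zero_idm.
  by case: (etaP (zob abC)) => _ h _; apply: epi_from_zero (zobP abC) h.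
have [Z Z0] := D0.
have cp c : character c -> c <> @zero_char k (full_subcategory D) ->
    c \o p <> @zero_char k C.
  move=> cC nc e0; apply: nc; apply/funext => Y.
  have : (c \o p) (sval Y) = 0%N by rewrite e0.
  rewrite /=; suff -> : c (p (sval Y)) = c Y by [].
  have [_ eY univ] := etaP (sval Y).
  have [r re] := univ _ (idm (sval Y)) (svalP Y).
  apply: (char_iso cC Z0 (f := (r : Mor (p (sval Y)) Y))).
  exists (eta (sval Y)); split=> //=.
  by apply: eY; rewrite -compA re compm1 comp1m.
exists (c1 \o p), (c2 \o p); split; try exact: reflection_char; try exact: cp.
by apply/funext => X; rewrite fx; apply: (congr1 (fun F => F (p X)) e).
Qed.

End Functor.

(** From left to right, the unit of the adjunction is an epimorphism because its
    image, a subobject of an object of [D], lies in [D].  From right to left,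
    irreducibility is preserved because composing with the reflection turns
    characters of [D] into characters ([restrict_irreducible]). *)
Lemma Sp_subE (D : set C) (chi : Sp C) : subobject_closed_subcat D ->
  Sp_sub D chi <-> fixes D (sval chi).
Proof.
move=> [[Z [Z0 DZ]] _ subD]; split.
  move=> [c [p [[eta univ] e]]].
  have eta_epi X : epi (eta X).
    have [I [e1 [m [e1e mm me]]]] := image_factorization abC (eta X).
    have DI : D I by apply: subD mm (svalP (p X)).
    have [g [ge _]] := univ X (exist _ I DI) e1.
    have [h [_ hu]] := univ X (p X) (eta X).
    have mg : m ∘ g = idm _.
      by rewrite -(hu (m ∘ g)) ?(hu (idm _)) ?comp1m //= -compA ge.
    suff im : iso m by rewrite -me; apply: epi_comp => //; apply: iso_epi.
    exists g; split=> //; apply: mm.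
    by rewrite compA mg comp1m compm1.
  have rP X : reflection D (eta X).
    split=> //; first exact: svalP.
    by move=> N f DN; have [g [ge _]] := univ X (exist _ N DN) f; exists g.
  move=> X; exists (sval (p X)), (eta X); split=> //; rewrite e /=.
  have [cC _ _] := svalP c.
  have Z0' : @is_zero k (full_subcategory D) (exist _ Z DZ).
    by apply/zero_idm/(zero_idm Z).
  have [_ _ u'] := rP (sval (p X)).
  have [r re] := u' _ (idm _) (svalP (p X)).
  apply/esym; apply: (char_iso cC Z0' (f := (r : Mor (p (sval (p X))) (p X)))).
  exists (eta (sval (p X))); split=> //=.
  by apply: eta_epi; rewrite -compA re compm1 comp1m.
move=> fx.
pose X' X := projT1 (cid (fx X)).
pose eta X : Mor X (X' X) := projT1 (cid (projT2 (cid (fx X)))).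
have etaP X : reflection D (eta X) /\ sval chi X = sval chi (X' X).
  exact: projT2 (cid (projT2 (cid (fx X)))).
have DX X : D (X' X) by have [[]] := etaP X.
pose p X : full_subcategory D := exist _ (X' X) (DX X).
have rP X : reflection D (eta X : Mor X (sval (p X))) by case: (etaP X).
have fx' X : sval chi X = sval chi (sval (p X)) by case: (etaP X).
exists (exist _ _ (restrict_irreducible rP (svalP chi) fx')), p; split.
  exists eta => X Y f; have [_ ee u] := rP X.
  have [g ge] := u _ f (svalP Y); exists g; split=> // g' g'e.
  by apply: ee; rewrite ge.
by apply/funext => X; rewrite /= -fx'.
Qed.

(** Morphisms to [M] factor through the reflection, which leaves Hom(-, M)
    unchanged. *)
Lemma Sp_sub_mem (D : set C) (M : C) (hM : irreducible_char (char_of M)) :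
  hom_finite C -> subobject_closed_subcat D -> reflective D -> D M ->
  Sp_sub D (exist _ (char_of M) hM).
Proof.
move=> finC Ds rD DM; apply/(Sp_subE _ Ds) => X; have [X' [e rP]] := rD X.
exists X', e; split=> //=.
have chiC := char_of_character abC finC M; have [_ ee univ] := rP.
rewrite -(rk_epi abC chiC ee) (char_of_no_defect abC finC) // => h.
by have [g ge] := univ _ h DM; exists g.
Qed.

(** ** Intersections *)

Section Intersection.
Variable DD : set (set C).
Hypothesis DDs : forall D, DD D -> subobject_closed_subcat D.
Hypothesis DDr : forall D, DD D -> reflective D.
Hypothesis accC : forall X : C, Acc (@proper_quotient k C) X.

Let E : set C := \bigcap_(D in DD) D.

Lemma subcat_bigcap : subobject_closed_subcat E.
Proof.
split.
- exists (zob abC); split; first exact: zobP.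
  move=> D /DDs[[Z [Z0 DZ]] _ sub].
  exact: sub (split_monoW (zero_split_mono (0 : Mor _ Z) (zobP abC))) DZ.
- by move=> X Y S s EX EY D DDD; have [_ h _] := DDs DDD; apply: h s _ _; [apply: EX|apply: EY].
- by move=> X Y i im EY D DDD; have [_ _ h] := DDs DDD; apply: h im _; apply: EY.
Qed.

(** The reflection into an intersection is reached by reflecting into the
    members again and again, which stops since proper quotients do. *)
Lemma reflection_bigcap X : exists X' (e : Mor X X'), reflection E e /\
  forall chi, character chi -> (forall D, DD D -> fixes D chi) -> chi X = chi X'.
Proof.
elim: (accC X) => {}X _ ih; have [EX|nE] := EM (E X).
  exists X, (idm X); split=> //; split=> //; first exact/iso_epi/iso_id.
  by move=> N f _; exists f; rewrite compm1.
have [D [DDD nD]] : exists D, DD D /\ ~ D X.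
  apply: contrapT => ne; apply: nE => D DDD; apply: contrapT => nD.
  by apply: ne; exists D.
have [X1 [e1 re1]] := DDr DDD X; have [DX1 e1e univ1] := re1.
have [|X' [e [re eq]]] := ih X1.
  exists e1; split=> // ie; apply: nD; have [_ _ sub] := DDs DDD.
  exact: sub (iso_mono ie) DX1.
have [EX' ee univ] := re; exists X', (e ∘ e1); split.
  split=> //; first exact: epi_comp.
  move=> N f EN; have [g ge] := univ1 _ f (EN D DDD).
  by have [g' g'e] := univ _ g EN; exists g'; rewrite compA g'e.
move=> chi chiC fx; rewrite -(eq _ chiC fx).
have [X2 [e2 [[DX2 e2e univ2] ->]]] := fx D DDD X.
have [g ge] := univ1 _ e2 DX2; have [g' ge'] := univ2 _ e1 DX1.
apply/eqP; rewrite eqn_leq; apply/andP; split; apply: (char_le abC chiC).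
  by apply: (@epi_factor _ _ _ _ _ g e1); rewrite ge.
by apply: (@epi_factor _ _ _ _ _ g' e2); rewrite ge'.
Qed.

Lemma fixes_bigcap chi : character chi ->
  fixes E chi <-> forall D, DD D -> fixes D chi.
Proof.
move=> chiC; split=> [fx D DDD|fx X].
  apply: (fixesP chiC (DDr DDD)) => X; have [X' [e [[EX' ee _] eq]]] := fx X.
  by exists X', e; split=> //; apply: EX'.
by have [X' [e [re eq]]] := reflection_bigcap X; exists X', e; split=> //; apply: eq.
Qed.

Lemma Sp_sub_bigcap : Sp_sub E = \bigcap_(D in DD) @Sp_sub k C D.
Proof.
apply/seteqP; split=> chi; have [chiC _ _] := svalP chi.
  move=> /(Sp_subE _ subcat_bigcap)/(fixes_bigcap chiC) h D DDD.
  by apply/(Sp_subE _ (DDs DDD)); apply: h.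
move=> h; apply/(Sp_subE _ subcat_bigcap)/(fixes_bigcap chiC) => D DDD.
by apply/(Sp_subE _ (DDs DDD)); apply: h.
Qed.

End Intersection.

(** ** The objects whose morphisms from [G] kill a given subobject *)

Section Annihilator.
Variables (G G' : C) (e : Mor G G').
Hypothesis ee : epi e.
Hypothesis accC : forall X : C, Acc (@proper_quotient k C) X.

Definition annihilator : set C := [set N | forall u : Mor G N, Under u ⊑ Under e].

Lemma subcat_annihilator : subobject_closed_subcat annihilator.
Proof.
split.
- exists (zob abC); split; first exact: zobP.
  by move=> u; exists 0; have [_ h] := zobP abC; apply: h.
- move=> X Y S [i [j [p [q [_ _ _ _ sum]]]]] hX hY u.
  have -> : u = i ∘ (p ∘ u) + j ∘ (q ∘ u) by rewrite !compA -compDl sum comp1m.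
  by apply: ule_add; apply: ule_comp.
move=> X Y i im hY u; have [t /= ht] := hY (i ∘ u).
have [K [l lP]] := kernel_ex abC e; have [el _] := lP.
have [s se] : exists s, s ∘ e = u.
  apply: (cokernel_lift (epi_cokernel abC ee lP)); apply: (mono0 im).
  by rewrite compA ht -compA el compm0.
by exists s; rewrite /= se.
Qed.

(** As long as some [u : G -> X] does not factor through [e], push [e] out along
    [u].  The exact sequence from [G] via the sum of [G'] and [X] to the pushout
    shows that a character with equal values at [G] and [G'] is unchanged by
    this.  The process stops since proper quotients are well-founded. *)
Lemma reflection_annihilator X : exists X' (r : Mor X X'),
  reflection annihilator r /\
  forall chi, character chi -> chi G = chi G' -> chi X = chi X'.
Proof.
elim: (accC X) => {}X _ ih; have [aX|naX] := EM (annihilator X).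
  exists X, (idm X); split=> //; split=> //; first exact/iso_epi/iso_id.
  by move=> N f _; exists f; rewrite compm1.
have [u nu] : exists u : Mor G X, ~ Under u ⊑ Under e.
  by apply: contrapT => ne; apply: naX => u; apply: contrapT => nu; apply: ne; exists u.
have [P [v [w po]]] := pushout_ex abC e u; have [vw univ _] := po.
have we := pushout_epi po ee.
have [|X' [r [re eq]]] := ih P.
  exists w; split=> // -[s [sw _]]; apply: nu; exists (s ∘ v).
  by rewrite /= -compA vw compA sw comp1m.
have [aX' rr runiv] := re; exists X', (r ∘ w); split.
  split=> //; first exact: epi_comp.
  move=> N f aN; have [t /= ht] := aN (f ∘ u).
  have [g [_ gw]] := univ _ t f (esym ht).
  by have [g' g'r] := runiv _ g aN; exists g'; rewrite compA g'r.
move=> chi chiC GG; rewrite -(eq _ chiC GG).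
have [S [i [j [p [q sP]]]]] := sum_ex abC G' X.
have := chiC.2 _ _ _ _ _ (pushout_cokernel_pair po sP).
have -> : chi S = (chi G' + chi X)%N by apply: chiC.1; exists i, j, p, q.
have := char_le abC chiC we; lia.
Qed.

Lemma Sp_sub_annihilator :
  Sp_sub annihilator = [set chi : Sp C | sval chi G = sval chi G'].
Proof.
apply/seteqP; split=> chi /=; have [chiC _ _] := svalP chi.
  move=> /(Sp_subE _ subcat_annihilator)/(_ G)[X' [r [[aX' rr _] eq]]].
  have [t ht] : exists t : Mor G' X', r = t ∘ e := aX' r.
  have te : epi t by apply: (@epi_factor _ _ _ _ _ t e); rewrite -ht.
  apply/eqP; rewrite eqn_leq (char_le abC chiC ee) andbT eq.
  exact (char_le abC chiC te).
move=> GG; apply/(Sp_subE _ subcat_annihilator) => X.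
have [X' [r [re eq]]] := reflection_annihilator X.
by exists X', r; split=> //; apply: eq.
Qed.

End Annihilator.

End Reflections.

(** * Linked subquotients *)

Section Linking.
Variables (k : comPzRingType) (C : linCategory k).
Hypothesis abC : abelian C.
Variables (V : set (Sp C)) (chi : C -> nat).
Hypothesis irr : irreducible_char chi.
Implicit Types X Y Z : C.

Let chiC : character chi. Proof. by case: irr. Qed.

(** The steps that count are the subquotients on which all members of [V]
    vanish; their weight is the rank with respect to [chi]. *)
Definition vanishing_weight X (b c : under X) (w : nat) : Prop :=
  w = 0%N \/ (w + rk abC chi (arr b) <= rk abC chi (arr c))%N /\
    forall psi, V psi -> rk abC (sval psi) (arr b) = rk abC (sval psi) (arr c).

Lemma vanishing_weightP : weight abC vanishing_weight.
Proof.
have charV (psi : Sp C) : character (sval psi) by case: (svalP psi).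
split.
- by move=> X b c _; left.
- move=> X b b' c c' w bb b'b cc c'c [->|[le eqV]]; [by left|right].
  rewrite -(rk_equiv abC chiC bb b'b) -(rk_equiv abC chiC cc c'c); split=> // psi Vpsi.
  rewrite -(rk_equiv abC (charV psi) bb b'b) -(rk_equiv abC (charV psi) cc c'c).
  exact: eqV.
- move=> X b c x w bc [->|[le eqV]].
    by exists 0%N, 0%N; split=> //; left.
  have mle := umeet_le abC x bc; have jle := ujoin_le abC x bc.
  have hb := rk_modular abC b x chiC; have hc := rk_modular abC c x chiC.
  have eqm psi : V psi ->
      rk abC (sval psi) (arr (umeet abC b x)) = rk abC (sval psi) (arr (umeet abC c x)) /\
      rk abC (sval psi) (arr (ujoin abC b x)) = rk abC (sval psi) (arr (ujoin abC c x)).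
    move=> Vpsi; have := eqV _ Vpsi.
    have := rk_modular abC b x (charV psi); have := rk_modular abC c x (charV psi).
    have := rk_le abC (charV psi) mle; have := rk_le abC (charV psi) jle.
    lia.
  exists (rk abC chi (arr (umeet abC c x)) - rk abC chi (arr (umeet abC b x)))%N.
  exists (rk abC chi (arr (ujoin abC c x)) - rk abC chi (arr (ujoin abC b x)))%N.
  have := rk_le abC chiC mle; have := rk_le abC chiC jle => lej lem.
  split; [right|right|by lia]; (split; first by lia); by move=> psi /eqm[].
move=> X Y Z f c cP a b w ca ab; have cb := ule_trans ca ab.
rewrite /vanishing_weight (rk_pull abC cP chiC ca) (rk_pull abC cP chiC cb).
split=> -[->|[le eqV]]; [by left|right|by left|right]; (split; first by lia);
  move=> psi /eqV; rewrite (rk_pull abC cP (charV psi) ca) (rk_pull abC cP (charV psi) cb).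
  by move=> ->.
by move=> /addIn.
Qed.

Lemma vanishing_weight_rk X (b c : under X) w : b ⊑ c -> vanishing_weight b c w ->
  (w + rk abC chi (arr b) <= rk abC chi (arr c))%N.
Proof. by move=> bc [->|[]//]; apply: rk_le. Qed.

Lemma chain_positive_step X (a c : under X) n :
  chain vanishing_weight a c n -> (0 < n)%N ->
  exists b d w, [/\ (0 < w)%N, vanishing_weight b d w & d ⊑ c].
Proof.
elim=> [//|b d m w _ ih bd wbd].
have [w0|w0 _] := posnP w; last by exists b, d, w; split=> //; apply: ule_refl.
rewrite w0 addn0 => /ih[b' [d' [w' [w'0 h d'b]]]].
by exists b', d', w'; split=> //; apply: ule_trans bd.
Qed.

(** The subquotients on which all of [V] vanishes carry a subcharacter of
    [chi].  As soon as one of them is seen by [chi], irreducibility makes this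
    subcharacter all of [chi], so every subquotient seen by [chi] contains one
    of them; apply this to an image of minimal rank. *)
Lemma linked_subquotient X Y (f : Mor X Y) :
  (rk abC chi f < chi X)%N ->
  (forall psi, V psi -> rk abC (sval psi) f = sval psi X) ->
  exists W (b c : under W), [/\ rk abC chi (arr b) = 0%N,
    (0 < rk abC chi (arr c))%N
  & forall psi, V psi -> rk abC (sval psi) (arr b) = rk abC (sval psi) (arr c)].
Proof.
move=> lt eqV; have wW := vanishing_weightP; have dom := vanishing_weight_rk.
have bW := dominated_bounded chiC dom.
have full : chain_char abC vanishing_weight = chi.
  have [e|//] := chain_char_irreducible wW chiC dom irr.
  have := chain_char_source wW bW f; rewrite e /zero_char.
  have [_ mx] := chain_valP wW bW (ule_top (Under f)).
  suff : (chi X - rk abC chi f <= chain_val vanishing_weight (Under f) (utop X))%N.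
    by lia.
  apply: mx; apply: (chain_step (n := 0)) (ule_top _) _; first exact: chain_nil.
  right; rewrite /= (rk_idm abC chiC); split; first by lia.
  move=> psi Vpsi; rewrite eqV // rk_idm //; by case: (svalP psi).
(* A rank below the least positive rank [n] is zero. *)
pose P n := `[< (0 < n)%N /\ exists W (g : under W), rk abC chi (arr g) = n >].
have exP : exists n, P n.
  exists (chi X); apply/asboolP; split; first by lia.
  by exists X, (utop X); apply: rk_idm.
have [n /asboolP[n0 [W [g gn]]] mn] := ex_minnP exP.
have vg : (0 < chain_val vanishing_weight (ubot abC W) g)%N.
  have := chain_val_rk wW chiC dom (ule_top g).
  have := chain_val_add wW bW (ule_bot abC g) (ule_top g).
  have : chain_char abC vanishing_weight W = chi W by rewrite full.
  by rewrite /chain_char /= (rk_idm abC chiC) gn; lia.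
have [h _] := chain_valP wW bW (ule_bot abC g).
have [b [d [w [w0 [e|[le eqbd]] dg]]]] := chain_positive_step h vg.
  by rewrite e in w0.
exists W, b, d; split=> //; last by lia.
have dn := rk_le abC chiC dg; rewrite gn in dn.
apply/eqP; rewrite -leqn0 leqNgt; apply/negP => b0.
have PB : P (rk abC chi (arr b)) by apply/asboolP; split=> //; exists W, b.
have := mn _ PB; lia.
Qed.

End Linking.

(** * Finite subobject-closed subsets *)

Section FiniteType.
Variables (k : comPzRingType) (C : linCategory k).
Hypothesis abC : abelian C.
Implicit Types X Y Z : C.

Lemma cokernel_sum_source A B X Y K L i j p q (f : Mor X Y) (c : Mor Y K)
    (d : Mor K L) :
  [/\ p ∘ i = idm A, q ∘ j = idm B, p ∘ j = 0, q ∘ i = 0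
    & i ∘ p + j ∘ q = idm X] ->
  is_cokernel (f ∘ i) c -> is_cokernel (c ∘ (f ∘ j)) d -> is_cokernel f (d ∘ c).
Proof.
move=> [_ _ _ _ e] cP dP; have [cfi _] := cP; have [dcfj _] := dP.
apply: cokernelP.
- exact: epi_comp (cokernel_epi dP) (cokernel_epi cP).
- have hi : d ∘ c ∘ f ∘ i = 0 by rewrite -!compA cfi compm0.
  have hj : d ∘ c ∘ f ∘ j = 0 by rewrite -!compA dcfj.
  by rewrite -[LHS]compm1 -e compDr !compA hi hj !comp0m addr0.
move=> W h hf; have [|s sc] := cokernel_lift (h := h) cP.
  by rewrite compA hf comp0m.
have [|t td] := cokernel_lift (h := s) dP.
  by rewrite compA sc compA hf comp0m.
by exists t; rewrite compA td.
Qed.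

Lemma rk_sum_source (chi : C -> nat) A B X Y i j p q (f : Mor X Y) :
  character chi ->
  [/\ p ∘ i = idm A, q ∘ j = idm B, p ∘ j = 0, q ∘ i = 0
    & i ∘ p + j ∘ q = idm X] ->
  rk abC chi f =
  (rk abC chi (f ∘ i) + rk abC chi (cokm abC (f ∘ i) ∘ (f ∘ j)))%N.
Proof.
move=> chiC sP; have cP := cokP abC (f ∘ i).
have dP := cokP abC (cokm abC (f ∘ i) ∘ (f ∘ j)).
have := rk_cokernel abC chiC (cokernel_sum_source sP cP dP).
have := rk_cokernel abC chiC cP; have := rk_cokernel abC chiC dP; lia.
Qed.

Lemma rk_pushout_epi (chi : C -> nat) X Y X' P (e : Mor X X') (f : Mor X Y)
    (u : Mor X' P) (v : Mor Y P) :
  character chi -> epi e -> is_pushout e f u v -> chi X = chi X' ->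
  rk abC chi u = rk abC chi f.
Proof.
move=> chiC ee po eq.
have [S [i [j [p [q sP]]]]] := sum_ex abC X' Y.
have [c' [_ _ cP']] := pushout_cokernel_side (pushout_sym po) (cokP abC f).
have := chiC.2 _ _ _ _ _ (pushout_cokernel_pair po sP).
have -> : chi S = (chi X' + chi Y)%N by apply: chiC.1; exists i, j, p, q.
have := char_le abC chiC (pushout_epi po ee).
have := rk_cokernel abC chiC cP'; have := rk_cokernel abC chiC (cokP abC f).
lia.
Qed.

Hypothesis accC : forall X : C, Acc (@proper_quotient k C) X.

(** Induction on [psi X - rk psi f], then on [X]: an indecomposable source in
    [D] lets the almost split morphism split off, which lowers the first
    number, and any other source is replaced by proper quotients. *)
Lemma vanish_on_subcat (D : set C) (chi psi : C -> nat) :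
  subobject_closed_subcat D -> character chi -> character psi ->
  (forall X, exists X' (e : Mor X X'),
     [/\ D X', epi e, chi X = chi X' & psi X = psi X']) ->
  (forall M, indecomposable M -> D M -> exists N (a : Mor M N),
     [/\ left_almost_split a, rk abC chi a = chi M & (rk abC psi a < psi M)%N]) ->
  forall n X Y (f : Mor X Y), (psi X <= n + rk abC psi f)%N ->
    rk abC chi f = chi X.
Proof.
move=> [_ _ Dsub] chiC psiC quot las; elim/ltn_ind=> n ihn X.
elim: (accC X) => {}X _ ihX Y f le.
have [DX|nDX] := EM (D X); last first.
  have [X' [e [DX' ee eqc eqp]]] := quot X.
  have [P [u [v po]]] := pushout_ex abC e f.
  rewrite -(rk_pushout_epi chiC ee po eqc) eqc; apply: ihX.
    by exists e; split=> // ie; apply: nDX; apply: Dsub (iso_mono ie) DX'.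
  by rewrite (rk_pushout_epi psiC ee po eqp) -eqp.
have [X0|nX0] := EM (is_zero X).
  by have := rk_source abC chiC f; rewrite (char_zero chiC X0); lia.
have [indX|nind] := EM (indecomposable X); last first.
  have [A [B [s nA nB]]] := decomposable nX0 nind.
  have [qA qB] := sum_proper_quotient s nA nB.
  have eqc := chiC.1 _ _ _ s; have eqp := psiC.1 _ _ _ s.
  have [i [j [p [q sP]]]] := s.
  rewrite (rk_sum_source f chiC sP) eqc; rewrite (rk_sum_source f psiC sP) in le.
  have := rk_source abC psiC (f ∘ i).
  have := rk_source abC psiC (cokm abC (f ∘ i) ∘ (f ∘ j)).
  by move=> l1 l2; congr addn; [apply: ihX qA _ _ _|apply: ihX qB _ _ _]; lia.
have [[r rf]|nsplit] := EM (split_mono f).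
  apply/eqP; rewrite eqn_leq rk_source //= -{1}(rk_idm abC chiC X) -rf.
  exact: rk_comp_le.
have [N [a [[_ univ] ca pa]]] := las X indX DX.
have [t ta] := univ _ f nsplit.
have [S [i [j [p [q sP]]]]] := sum_ex abC Y (cok abC a).
have cE := rk_comp_pair abC chiC t (cokP abC a) sP.
have pE := rk_comp_pair abC psiC t (cokP abC a) sP.
rewrite ta in cE pE.
suff : rk abC chi (i ∘ t + j ∘ cokm abC a) = chi N by lia.
have le' := rk_source abC psiC (i ∘ t + j ∘ cokm abC a).
by apply: (ihn n.-1); lia.
Qed.

Lemma character_sum (s : seq (Sp C)) :
  character (fun X => \sum_(x <- s) sval x X)%N.
Proof.
have xC (x : Sp C) : character (sval x) by case: (svalP x).
split=> [X Y S sum|X Y Z f g gP]; rewrite -big_split /=.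
  by apply: eq_bigr => x _; rewrite ((xC x).1 _ _ _ sum).
by apply: leq_sum => x _; apply: (xC x).2 gP.
Qed.

Hypothesis finC : hom_finite C.
Hypothesis lasC : forall M : C, indecomposable M ->
  exists (N : C) (f : Mor M N), left_almost_split f.

(** If [Sp_sub D] is finite, the sum of its members is a character that sees
    every almost split morphism starting in [D]; a member that sees none of
    them would vanish. *)
Lemma finite_Sp_sub (D : set C) (chi : Sp C) : subobject_closed_subcat D ->
  finite_set (Sp_sub D) -> Sp_sub D chi -> finite_char (sval chi).
Proof.
move=> Ds /finite_seqP[s sE] chiD; apply: contrapT => inf.
have [chiC nz _] := svalP chi.
have chiF : fixes D (sval chi) by apply/(Sp_subE abC _ Ds).
have rD := fixes_reflective chiF.
have psiC := character_sum s; set psi := (fun X => _) in psiC.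
apply: nz; apply/funext => X.
have := @vanish_on_subcat D (sval chi) psi Ds chiC psiC _ _ (psi X) X X 0.
rewrite (rk_zero abC chiC) => <- //; last by lia.
- move=> {}X; have [X' [e [[DX' ee univ] eq]]] := chiF X.
  exists X', e; split=> //; apply: eq_big_seq => x xs.
  have [xC _ _] := svalP x.
  have : Sp_sub D x by rewrite sE.
  move=> /(Sp_subE abC _ Ds)/(_ X)[X2 [e2 [[DX2 e2e univ2] ->]]].
  have [g ge] := univ _ e2 DX2; have [g' ge'] := univ2 _ e DX'.
  apply/eqP; rewrite eqn_leq; apply/andP; split; apply: (char_le abC xC).
    by apply: (@epi_factor _ _ _ _ _ g e); rewrite ge.
  by apply: (@epi_factor _ _ _ _ _ g' e2); rewrite ge'.
move=> M indM DM; have [N [a las]] := lasC indM; exists N, a; split=> //.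
  apply/eqP; rewrite eqn_leq rk_source // leqNgt; apply/negP => lt.
  by apply: inf; exists M; apply: irreducible_las las (svalP chi) lt.
have irrM := char_of_irreducible abC finC las.
pose x : Sp C := exist _ (char_of M) irrM.
have xs : x \in s.
  have : Sp_sub D x by exact: Sp_sub_mem.
  by rewrite sE.
have -> : psi = (fun X => sval x X + \sum_(y <- rem x s) sval y X)%N.
  by apply/funext => Y; rewrite /psi (big_rem x).
have [xC _ _] := irrM; have restC := character_sum (rem x s).
rewrite (rk_add abC a xC restC).
have := rk_source abC restC a; have := char_of_las abC finC las; rewrite /=; lia.
Qed.

End FiniteType.

(** * The topology *)

Section Topology.
Variables (k : comPzRingType) (C : linCategory k).
Hypothesis abC : abelian C.
Implicit Types X Y Z : C.

Lemma basic_openE X Y (f : Mor X Y) (chi : Sp C) :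
  basic_open f chi <-> (rk abC (sval chi) f < sval chi X)%N.
Proof.
have [chiC _ _] := svalP chi; have le := rk_source abC chiC f.
split=> [[Z [g [gP]]]|lt]; last exists (cok abC f), (cokm abC f).
  by have := rk_cokernel abC chiC gP; lia.
by split; [exact: cokP|have := rk_cokernel abC chiC (cokP abC f); lia].
Qed.

Lemma basic_open_open X Y (f : Mor X Y) : open (basic_open f).
Proof.
exists [set basic_open f]; last by rewrite bigcup_set1.
move=> _ ->; apply: (@finI_from1 _ _ _ id); by exists X, Y, f.
Qed.

Lemma open_subbase (A : set (Sp C)) (chi : Sp C) : open A -> A chi ->
  exists2 F : set (set (Sp C)), finite_set F &
    (forall B, F B -> B chi /\ exists X Y (f : Mor X Y), B = basic_open f) /\
    \bigcap_(B in F) B `<=` A.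
Proof.
move=> [D' sD' <-] [B D'B Bchi]; have [F sF FB] := sD' _ D'B.
exists [set` F]; first exact: finite_fset.
split; last by move=> psi psiF; exists B => //; rewrite -FB.
move=> B' B'F; split; first by move: Bchi; rewrite -FB; apply.
by have := sF _ B'F; rewrite inE.
Qed.

Hypothesis finC : hom_finite C.
Hypothesis accC : forall X : C, Acc (@proper_quotient k C) X.
Hypothesis lasC : forall M : C, indecomposable M ->
  exists (N : C) (f : Mor M N), left_almost_split f.

(** Let [a] be the almost split morphism starting at an indecomposable summand
    [M] of an object representing [chi].  The inclusion of [M] does not factor
    through [a], so [chi] lies in the basic open set of [a], and this set has no
    further point by [irreducible_las]. *)
Lemma finite_char_isolated (chi : Sp C) : finite_char (sval chi) ->
  open [set chi].
Proof.
move=> [M' eM']; have [chiC nz _] := svalP chi.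
have nM' : ~ is_zero M'.
  move=> M0; apply: nz; apply/funext => X; rewrite eM'.
  rewrite -(char_of_no_defect abC finC (f := 0 : Mor X X)) => [|h].
    by rewrite (rk_zero abC (char_of_character abC finC M')).
  by exists 0; have [_ hz] := M0; apply: hz.
have [M [s [indM [r rs]]]] := indecomposable_summand (accC M') nM'.
have [N [a las]] := lasC indM.
suff -> : [set chi] = basic_open a by apply: basic_open_open.
have chi_a : (rk abC (sval chi) a < sval chi M)%N.
  rewrite eM'; apply: (char_of_defect abC finC (h := s)) => -[t /= st].
  by case: las => + _; apply; exists (r ∘ t); rewrite -compA -st.
apply/seteqP; split=> [_ ->|psi /basic_openE psi_a]; first exact/basic_openE.
apply/eq_sig_hprop => [? ? ?|]; first exact: Prop_irrelevance.
rewrite (irreducible_las finC las (svalP psi) psi_a).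
by rewrite (irreducible_las finC las (svalP chi) chi_a).
Qed.

Lemma sub_char_mem (chi : Sp C) : sub_char chi chi.
Proof. by move=> U []. Qed.

Lemma subobject_closed_kernel G G' (e : Mor G G') : epi e ->
  subobject_closed [set chi : Sp C | sval chi G = sval chi G'].
Proof.
move=> ee; exists (annihilator e); split; first exact: subcat_annihilator.
by rewrite Sp_sub_annihilator.
Qed.

Lemma subobject_closed_bigcap (FF : set (set (Sp C))) (chi : Sp C) :
  (forall U, FF U -> subobject_closed U /\ U chi) ->
  subobject_closed (\bigcap_(U in FF) U).
Proof.
move=> FFs.
pose DD : set (set C) := [set D | subobject_closed_subcat D /\ FF (Sp_sub D)].
have DDs D : DD D -> subobject_closed_subcat D by case.
have DDr D : DD D -> reflective D.
  by move=> [Ds /FFs[_ /(Sp_subE abC _ Ds)]]; apply: fixes_reflective.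
exists (\bigcap_(D in DD) D); split; first exact: subcat_bigcap.
rewrite (Sp_sub_bigcap abC DDs DDr accC).
apply/seteqP; split=> psi h; first by move=> D [Ds FD]; apply: h.
move=> U FU; have [[D [Ds e]] _] := FFs U FU; rewrite e; apply: h.
by split=> //; rewrite -e.
Qed.

Lemma subobject_closed_sub_char (chi : Sp C) : subobject_closed (sub_char chi).
Proof. by apply: (@subobject_closed_bigcap _ chi) => V [Vs Vchi]. Qed.

(** Suppose that infinitely many points vanish on [f].  Linking yields
    morphisms [b] and [c] such that [chi] has rank zero on [b] but not on [c],
    while the ranks of the points vanishing on [f] agree on [b] and [c].  The
    characters of rank zero on a given morphism form a subobject-closed subset.
    For [b] this subset contains [chi], hence all of [sub_char chi]; for [c] it
    therefore contains infinitely many points, hence by minimality all of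
    [sub_char chi], and in particular [chi]. *)
Lemma basic_open_cofinite (chi : Sp C) X Y (f : Mor X Y) :
  minimal_infinite_subobject_closed (sub_char chi) -> basic_open f chi ->
  finite_set (sub_char chi `&` ~` basic_open f).
Proof.
move=> [_ Us Umin] /basic_openE lt; apply: contrapT => infV.
set V := _ `&` _ in infV.
have [|W [b [c [b0 c0 eqV]]]] := linked_subquotient (V := V) (svalP chi) lt.
  move=> psi [_ npsi]; have [psiC _ _] := svalP psi; apply/eqP.
  rewrite eqn_leq rk_source // leqNgt; apply/negP => lt'.
  by apply: npsi; apply/basic_openE.
pose kernel (d : under W) := [set psi : Sp C | rk abC (sval psi) (arr d) = 0%N].
have kernelE d : kernel d =
    [set psi | sval psi (cod d) = sval psi (cok abC (arr d))].
  apply/seteqP; split=> psi /=; have [psiC _ _] := svalP psi;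
    have := rk_cokernel abC psiC (cokP abC (arr d)); rewrite /kernel /=; lia.
have kernel_closed d : subobject_closed (kernel d).
  rewrite kernelE; apply: subobject_closed_kernel.
  exact: cokernel_epi (cokP abC (arr d)).
have Vc : V `<=` sub_char chi `&` kernel c.
  move=> psi Vpsi; have [Upsi _] := Vpsi; split=> //.
  by rewrite /kernel /= -eqV //; apply: (Upsi (kernel b)).
have [psi Vpsi] : exists psi, V psi.
  apply: contrapT => ne; apply: infV; suff -> : V = set0 by apply: finite_set0.
  by apply/seteqP; split=> // psi Vpsi; apply: ne; exists psi.
have closedI : subobject_closed (sub_char chi `&` kernel c).
  have -> : sub_char chi `&` kernel c = \bigcap_(U in [set sub_char chi; kernel c]) U.
    by rewrite bigcap_setU !bigcap_set1.
  have [Upsi kpsi] := Vc _ Vpsi.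
  by apply: (@subobject_closed_bigcap _ psi) => _ [->|->].
have infI : infinite_set (sub_char chi `&` kernel c).
  by move=> /(sub_finite_set Vc).
have := @sub_char_mem chi; rewrite -(Umin _ infI closedI (@subIsetl _ _ _)).
by move=> [_]; rewrite /kernel /=; lia.
Qed.

(** The member of a cover that contains [chi] leaves out only finitely many
    points. *)
Lemma compact_sub_char (chi : Sp C) :
  minimal_infinite_subobject_closed (sub_char chi) -> cover_compact (sub_char chi).
Proof.
move=> Umin I D F Fopen cov.
have [i0 Di0 Fchi] := cov _ (@sub_char_mem chi).
have [B finB [BF subF]] := open_subbase (Fopen _ Di0) Fchi.
have : finite_set (sub_char chi `&` ~` F i0).
  apply: (@sub_finite_set _ _ (\bigcup_(O in B) (sub_char chi `&` ~` O))).
    move=> psi [Upsi npsi]; apply: contrapT => nex; apply/npsi/subF => O BO.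
    by apply: contrapT => nO; apply: nex; exists O.
  apply: bigcup_finite => // O /BF[Ochi [X [Y [f e]]]].
  by rewrite e in Ochi *; apply: basic_open_cofinite.
move=> /finite_seqP[s sE].
have idx psi : exists i, sub_char chi psi -> D i /\ F i psi.
  have [/cov[i Di Fi]|nU] := EM (sub_char chi psi); first by exists i.
  by exists i0.
pose g psi := projT1 (cid (idx psi)).
have gP psi : sub_char chi psi -> D (g psi) /\ F (g psi) psi.
  exact: projT2 (cid (idx psi)).
have sU psi : psi \in s -> sub_char chi psi.
  by move=> ps; have : [set` s] psi by []; rewrite -sE => -[].
exists [fset i | i in i0 :: map g s]%fset.
  move=> i; rewrite !inE /= => /predU1P[->|/mapP[psi ps ->]] //.
  by case: (gP psi (sU _ ps)).
move=> psi Upsi; have [Fpsi|nF] := EM (F i0 psi).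
  by exists i0 => //=; rewrite !inE eqxx.
have ps : psi \in s by have : (sub_char chi `&` ~` F i0) psi by []; rewrite sE.
exists (g psi); last by case: (gP psi Upsi).
by rewrite /= !inE /= map_f ?orbT.
Qed.

(** If all points were finite characters, then the compact set would be
    discrete. *)
Lemma compact_infinite_char (U : set (Sp C)) : infinite_set U -> cover_compact U ->
  exists chi, U chi /\ infinite_char (sval chi).
Proof.
move=> infU cU; apply: contrapT => nex.
have isol chi : U chi -> open [set chi].
  move=> Uchi; apply: finite_char_isolated; apply: contrapT => inf.
  by apply: nex; exists chi.
have [|D' _ sub] := cU (Sp C) U (fun chi => [set chi]) isol.
  by move=> chi Uchi; exists chi.
apply: infU; apply: (sub_finite_set sub).
apply: bigcup_finite; first exact: finite_fset.
by move=> chi _; apply: finite_set1.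
Qed.

(** A finite subobject-closed subset has only finite characters as points, so
    the one generated by [chi] is infinite, and minimality applies. *)
Lemma infinite_char_sub_char (U : set (Sp C)) (chi : Sp C) :
  minimal_infinite_subobject_closed U -> U chi -> infinite_char (sval chi) ->
  U = sub_char chi.
Proof.
move=> [infU Us Umin] Uchi inf; apply/esym/Umin.
- have [D [Ds e]] := subobject_closed_sub_char chi.
  move=> fin; apply: inf.
  apply: (@finite_Sp_sub _ _ abC accC finC lasC D) => //; rewrite -e //.
  exact: sub_char_mem.
- exact: subobject_closed_sub_char.
by move=> psi; apply.
Qed.

End Topology.

Theorem proposition5p1 (k : comPzRingType) (C : linCategory k)
  (hlen : abelian_length_category C) (hfin : hom_finite C)
  (hlas : forall M : C, indecomposable M ->
     exists (N : C) (f : Mor M N), left_almost_split f)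
  (U : set (Sp C)) (hU : minimal_infinite_subobject_closed U) :
  (cover_compact U <-> exists chi : Sp C, U chi /\ infinite_char (sval chi)) /\
  ((exists chi : Sp C, U chi /\ infinite_char (sval chi)) <->
   exists chi : Sp C, U = sub_char chi).
Proof.
have [abC lenC] := hlen; have accC X := finite_length_acc abC (lenC X).
have [infU _ _] := hU.
have c12 : cover_compact U -> exists chi : Sp C, U chi /\ infinite_char (sval chi).
  exact: compact_infinite_char.
have c23 : (exists chi : Sp C, U chi /\ infinite_char (sval chi)) ->
    exists chi : Sp C, U = sub_char chi.
  by move=> [chi [Uchi inf]]; exists chi; apply: infinite_char_sub_char.
have c31 : (exists chi : Sp C, U = sub_char chi) -> cover_compact U.
  by move=> [chi e]; rewrite e in hU *; apply: compact_sub_char.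
by split; split=> //; [move=> /c23/c31|move=> /c31/c12].
Qed.
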